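(* Let $0=n_0<n_1<n_2<\cdots<n_k$ be $k+1$ given integers and let $a_0,a_1,\ldots,a_k$ be $k+1$ given nonzero real numbers. Then the following statements are equivalent: 1. The infinite dimensional quadratic form $$\sum_{n\in\mathbb{Z}}\left(a_0x_n+a_1x_{n+n_1}+a_2x_{n+n_2}+\cdots+a_kx_{n+n_k}\right)^2$$ is strongly positive definite. 2. The function $g=\sum_{j=0}^k a_j\chi_{F_j}$, where $F_j=[0,2\pi)+2n_j\pi$ for $j=0,1,\ldots,k$, is a mother Weyl-Heisenberg frame wavelet for $(2\pi,1)$.
   Context: A quadratic form $Q(x)$ defined for all real sequences $x=\{x_n\}_{n\in\mathbb{Z}}$ in $\ell^2(\mathbb{Z})$ is called strongly positive definite if there is a constant $c>0$ such that $Q(x)\ge c\|x\|^2$ for all real $x\in\ell^2(\mathbb{Z})$, where $\|x\|^2=\sum_{n\in\mathbb{Z}}x_n^2$. A collection $\{x_j\}_{j\in J}$ in a complex Hilbert space $H$ is a frame for $H$ if there exist constants $0<A\le B<\infty$ with $A\|f\|^2\le\sum_{j\in J}|\langle f,x_j\rangle|^2\le B\|f\|^2$ for all $f\in H$. For $a,b>0$ and $g\in L^2(\mathbb{R})$ (complex-valued functions, Lebesgue measure), let $T_ag(t)=g(t-a)$ and $M_bg(t)=e^{ibt}g(t)$. The function $g$ is called a mother Weyl-Heisenberg frame wavelet for $(a,b)$ if $\{M_{mb}T_{na}g\}_{m,n\in\mathbb{Z}}$ is a frame for $L^2(\mathbb{R})$. $\chi_S$ denotes the characteristic function of a set $S$.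 *)

(* Defs.v *)
From mathcomp Require Export all_boot all_order all_algebra.
From mathcomp Require Export all_classical all_reals all_analysis.
From mathcomp Require Export complex.

Set Implicit Arguments.
Unset Strict Implicit.
Unset Printing Implicit Defensive.

Import Order.TTheory GRing.Theory Num.Theory.
Import numFieldNormedType.Exports.

Local Open Scope classical_set_scope.
Local Open Scope ring_scope.

(* All the terms summed are nonnegative, so these sums over Z always make sense
   in [0, +oo]; [esum] is the supremum of the finite partial sums. *)
Definition l2_sqnorm (R : realType) (x : int -> R) : \bar R :=
  (\esum_(n in [set: int]) (x n ^+ 2)%:E)%E.

Definition in_l2 (R : realType) (x : int -> R) : Prop :=
  (l2_sqnorm x < +oo)%E.

Definition strongly_positive_definite (R : realType)
    (Q : (int -> R) -> \bar R) : Prop :=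
  exists2 c : R, 0 < c &
    forall x : int -> R, in_l2 x -> (c%:E * l2_sqnorm x <= Q x)%E.

Definition shift_form (R : realType) (k : nat) (n : 'I_k.+1 -> int)
    (a : 'I_k.+1 -> R) (x : int -> R) : \bar R :=
  (\esum_(m in [set: int]) ((\sum_(j < k.+1) a j * x (m + n j)) ^+ 2)%:E)%E.

(* An element of L2 is given by a Borel representative; [L2_dot] depends only
   on the classes of its arguments modulo equality almost everywhere. *)
Definition in_L2 (R : realType) (f : R -> R[i]) : Prop :=
  [/\ measurable_fun [set: R] (fun t => complex.Re (f t)),
      measurable_fun [set: R] (fun t => complex.Im (f t)) &
      (\int[@lebesgue_measure R]_t (ComplexField.Normc.normc (f t) ^+ 2)%:E < +oo)%E].

Definition Cintegral (R : realType) (h : R -> R[i]) : R[i] :=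
  (Rintegral (@lebesgue_measure R) setT (fun t => complex.Re (h t))
   +i* Rintegral (@lebesgue_measure R) setT (fun t => complex.Im (h t)))%C.

Definition L2_dot (R : realType) (f g : R -> R[i]) : R[i] :=
  Cintegral (fun t => f t * (g t)^*%C).

(* The Hilbert space is given as a subset [H] of a type [V], with its inner
   product [dot]; the squared norm of [f] is the (real) number [dot f f]. *)
Definition is_frame (R : realType) (V : Type) (H : set V)
    (dot : V -> V -> R[i]) (J : choiceType) (x : J -> V) : Prop :=
  (forall j, H (x j)) /\
  exists A B : R, [/\ 0 < A, A <= B &
    forall f, H f ->
      let S := (\esum_(j in [set: J])
                  (ComplexField.Normc.normc (dot f (x j)) ^+ 2)%:E)%E in
      ((A * complex.Re (dot f f))%:E <= S)%E /\
      (S <= (B * complex.Re (dot f f))%:E)%E].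

Definition expi (R : realType) (x : R) : R[i] := (cos x +i* sin x)%C.

Definition translation (R : realType) (a : R) (g : R -> R[i]) : R -> R[i] :=
  fun t => g (t - a).

Definition modulation (R : realType) (b : R) (g : R -> R[i]) : R -> R[i] :=
  fun t => expi (b * t) * g t.

Definition WH_system (R : realType) (a b : R) (g : R -> R[i])
    (mn : int * int) : R -> R[i] :=
  modulation (mn.1%:~R * b) (translation (mn.2%:~R * a) g).

Definition mother_WH_frame_wavelet (R : realType) (a b : R)
    (g : R -> R[i]) : Prop :=
  in_L2 g /\ is_frame (@in_L2 R) (@L2_dot R) (WH_system a b g).

Definition shifted_interval (R : realType) (m : int) : set R :=
  [set t + 2 * m%:~R * pi | t in `[0, 2 * pi[].

Definition step_function (R : realType) (k : nat) (n : 'I_k.+1 -> int)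
    (a : 'I_k.+1 -> R) : R -> R[i] :=
  fun t => (\sum_(j < k.+1) a j * \1_(shifted_interval (n j)) t)%:C%C.

(* Main.v *)
(** For [f] in L2, put [F_l s = \sum_j a_j f (s + 2 (l + n_j) pi)] on the period
[[0, 2 pi[]. The inner product of [f] with [M_m T_(2 pi l) g] is the [m]-th
(unnormalized) Fourier coefficient of [F_l], so by Parseval's identity the frame
sum of [f] is [2 pi] times the integral over the period of the quadratic form
evaluated at the samples [(f (s + 2 n pi))_n], whereas [||f||^2] is the integral
of the squared l2-norm of these samples. A lower bound for the form thus gives
one for the frame by integration (the samples are in l2 for almost every [s]);
conversely the frame inequality for [f] equal to [x_n] on
[[2 n pi, 2 (n + 1) pi[] is the inequality for the form at [x]. The upper frame
bound always holds.

Parseval's identity is obtained from the completeness of the real functions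
[cos (m t) + sin (m t)], which form a single orthogonal family indexed by
[m : int]. For completeness, iterating [u -> (3 u - u^3) / 2] on a trigonometric
polynomial that changes sign at [x] gives trigonometric polynomials converging
to its sign, hence approximates the indicator of [t > x]; a monotone class
argument then reaches the indicators of all Borel sets. *)
Require Import Defs.
From mathcomp Require Import finmap ring lra.
From mathcomp Require Import simple_functions measurable_realfun.
From mathcomp Require Import measurable_fun_approximation.

Set Implicit Arguments.
Unset Strict Implicit.
Unset Printing Implicit Defensive.

Import Order.TTheory GRing.Theory Num.Theory.
Import numFieldNormedType.Exports.

Local Open Scope classical_set_scope.
Local Open Scope ring_scope.

(** * Square integrable functions and orthogonal families *)

(** Closure rules rather than finite sums with coefficients, so that properties of trigonometric
    polynomials follow by induction; zero arises as [0 * e i]. *)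
Inductive span (T I : Type) (R : nzRingType) (e : I -> T -> R) :
    (T -> R) -> Prop :=
| span_base i : span e (e i)
| spanD f g : span e f -> span e g -> span e (fun x => f x + g x)
| spanZ c f : span e f -> span e (fun x => c * f x).

Section SquareIntegrable.
Context d (T : measurableType d) (R : realType).
Variables (mu : {measure set T -> \bar R}) (D : set T).
Hypothesis mD : measurable D.
Implicit Types f g h p : T -> R.

Definition square_integrable f :=
  measurable_fun setT f /\ (\int[mu]_(x in D) (f x ^+ 2)%:E < +oo)%E.

Definition dot f g : R := \int[mu]_(x in D) (f x * g x).

Lemma measurable_sqr f : measurable_fun setT f ->
  measurable_fun setT (fun x => (f x ^+ 2)%:E).
Proof. by move=> mf; apply/measurable_EFinP; exact: measurable_funX. Qed.

Lemma square_integrableW f g : measurable_fun setT f -> square_integrable g ->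
  (forall x, D x -> f x ^+ 2 <= g x ^+ 2) -> square_integrable f.
Proof.
move=> mf [mg ig] fg; split=> //; apply: le_lt_trans ig.
apply: ge0_le_integral => //.
- by move=> x _; rewrite lee_fin sqr_ge0.
- by apply: measurable_funTS; exact: measurable_sqr.
- by apply: measurable_funTS; exact: measurable_sqr.
Qed.

Lemma square_integrable_sqr f : square_integrable f ->
  mu.-integrable D (fun x => (f x ^+ 2)%:E).
Proof.
move=> [mf ff]; apply/integrableP; split.
  by apply: measurable_funTS; exact: measurable_sqr.
by under eq_integral do rewrite gee0_abs ?lee_fin ?sqr_ge0//.
Qed.

(** The product is dominated by [f ^+ 2 + g ^+ 2]. *)
Lemma integrable_dot f g : square_integrable f -> square_integrable g ->
  mu.-integrable D (fun x => (f x * g x)%:E).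
Proof.
move=> sf sg.
have := integrableD mD (square_integrable_sqr sf) (square_integrable_sqr sg).
apply: le_integrable => //.
  apply: measurable_funTS; apply/measurable_EFinP; apply: measurable_funM.
    by case: sf.
  by case: sg.
move=> x _ /=; rewrite lee_fin [leRHS]ger0_norm ?addr_ge0 ?sqr_ge0//.
rewrite normrM -(real_normK (num_real (f x))) -(real_normK (num_real (g x))).
have := normr_ge0 (f x); have := normr_ge0 (g x); nra.
Qed.

Lemma square_integrableD f g : square_integrable f -> square_integrable g ->
  square_integrable (fun x => f x + g x).
Proof.
move=> sf sg; have mfg : measurable_fun setT (fun x => f x + g x).
  by apply: measurable_funD; [case: sf|case: sg].
split=> //; apply: integrable_lty => //.
have i2 h : square_integrable h -> mu.-integrable D (fun x => 2%:E * (h x ^+ 2)%:E)%E.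
  by move=> sh; apply: integrableZl => //; exact: square_integrable_sqr.
have := integrableD mD (i2 _ sf) (i2 _ sg).
apply: le_integrable => //.
  by apply: measurable_funTS; exact: measurable_sqr.
move=> x _ /=; rewrite lee_fin !ger0_norm ?sqr_ge0//; last first.
  by have := sqr_ge0 (f x); have := sqr_ge0 (g x); lra.
have := sqr_ge0 (f x - g x); rewrite !expr2; nra.
Qed.

Lemma square_integrableZ c f : square_integrable f ->
  square_integrable (fun x => c * f x).
Proof.
move=> sf; have mcf : measurable_fun setT (fun x => c * f x).
  by apply: measurable_funM => //; case: sf.
split=> //; apply: integrable_lty => //.
have /(_ (c ^+ 2)) := integrableZl mD _ (square_integrable_sqr sf).
by apply: eq_integrable => // x _ /=; rewrite -EFinM exprMn.
Qed.

Lemma square_integrableB f g : square_integrable f -> square_integrable g ->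
  square_integrable (fun x => f x - g x).
Proof.
move=> sf /(square_integrableZ (-1)) /(square_integrableD sf).
by under eq_fun do rewrite mulN1r.
Qed.

Lemma square_integrable_sum (I : Type) (s : seq I) (F : I -> T -> R) :
  (forall i, square_integrable (F i)) ->
  square_integrable (fun x => \sum_(i <- s) F i x).
Proof.
move=> sF; elim: s => [|i s IH].
  under eq_fun do rewrite big_nil.
  split; first exact: measurable_cst.
  by under eq_integral do rewrite expr0n/=; rewrite integral0.
under eq_fun do rewrite big_cons; exact: square_integrableD.
Qed.

Lemma dotC f g : dot f g = dot g f.
Proof. by apply: eq_Rintegral => x _; rewrite mulrC. Qed.

Lemma dotDl f g h : square_integrable f -> square_integrable g ->
  square_integrable h -> dot (fun x => f x + g x) h = dot f h + dot g h.
Proof.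
move=> sf sg sh; rewrite /dot -RintegralD//; try exact: integrable_dot.
by apply: eq_Rintegral => x _; rewrite mulrDl.
Qed.

Lemma dotZl c f h : square_integrable f -> square_integrable h ->
  dot (fun x => c * f x) h = c * dot f h.
Proof.
move=> sf sh; rewrite /dot -RintegralZl//; last exact: integrable_dot.
by apply: eq_Rintegral => x _; rewrite mulrA.
Qed.

Lemma dotBl f g h : square_integrable f -> square_integrable g ->
  square_integrable h -> dot (fun x => f x - g x) h = dot f h - dot g h.
Proof.
move=> sf sg sh.
have := dotDl sf (square_integrableZ (-1) sg) sh.
rewrite dotZl// mulN1r => <-; congr dot.
by apply/funext => x; rewrite mulN1r.
Qed.

Lemma dot_suml (I : Type) (s : seq I) (c : I -> R) (F : I -> T -> R) h :
  (forall i, square_integrable (F i)) -> square_integrable h ->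
  dot (fun x => \sum_(i <- s) c i * F i x) h = \sum_(i <- s) c i * dot (F i) h.
Proof.
move=> sF sh; elim: s => [|i s IH].
  rewrite big_nil /dot; under eq_Rintegral do rewrite big_nil mul0r.
  by rewrite /Rintegral integral0.
rewrite big_cons -IH -dotZl// -dotDl//.
- by congr dot; apply/funext => x; rewrite big_cons.
- exact: square_integrableZ.
- by apply: square_integrable_sum => j; exact: square_integrableZ.
Qed.

Lemma dot_ge0 f : 0 <= dot f f.
Proof. by apply: Rintegral_ge0 => x _; rewrite -expr2 sqr_ge0. Qed.

Lemma EFin_dot f : square_integrable f ->
  (dot f f)%:E = (\int[mu]_(x in D) (f x ^+ 2)%:E)%E.
Proof.
move=> sf; rewrite /dot /Rintegral fineK; last first.
  by apply: integrable_fin_num => //; exact: integrable_dot.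
by apply: eq_integral => x _; rewrite expr2.
Qed.

Lemma dot_subr f g : square_integrable f -> square_integrable g ->
  dot (fun x => f x - g x) (fun x => f x - g x) =
  dot f f - 2 * dot f g + dot g g.
Proof.
move=> sf sg; have sB := square_integrableB sf sg.
rewrite dotBl// (dotC f) (dotC g) !dotBl// (dotC g f); ring.
Qed.

(** Parallelogram law with the term in [f - g] dropped. It replaces the triangle inequality and
    avoids square roots. *)
Lemma dot_addr_le f g : square_integrable f -> square_integrable g ->
  dot (fun x => f x + g x) (fun x => f x + g x) <= 2 * dot f f + 2 * dot g g.
Proof.
move=> sf sg; have sD := square_integrableD sf sg.
have := dot_ge0 (fun x => f x - g x).
have -> : dot (fun x => f x + g x) (fun x => f x + g x) =
    dot f f + 2 * dot f g + dot g g.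
  rewrite dotDl// (dotC f) (dotC g) !dotDl// (dotC g f); ring.
by rewrite dot_subr//; lra.
Qed.

(** * Bessel's inequality and Parseval's identity for an orthogonal family of common squared norm
    [K] *)

Section Orthogonal.
Variables (I : choiceType) (e : I -> T -> R) (K : R).
Hypotheses (K0 : 0 < K) (se : forall i, square_integrable (e i)).
Hypothesis dote : forall i j, dot (e i) (e j) = K *+ (i == j).

Lemma square_integrable_span p : span e p -> square_integrable p.
Proof.
elim=> [i|f g _ ? _ ?|c f _ ?] //; first exact: square_integrableD.
exact: square_integrableZ.
Qed.

Definition span_closure f := square_integrable f /\
  forall eps, 0 < eps -> exists2 p, span e p &
    dot (fun x => f x - p x) (fun x => f x - p x) <= eps.

(** Parseval's identity against an element of the span. Allowing every duplicate-free list that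
    contains [s] lets the lists of two summands be merged by concatenation in the induction. *)
Lemma span_coord p : span e p -> exists s : seq I, forall s', uniq s' ->
  {subset s <= s'} -> forall h, square_integrable h ->
  K * dot h p = \sum_(i <- s') dot h (e i) * dot (e i) p.
Proof.
elim=> [i|f g pf [sf Hf] pg [sg Hg]|c f pf [sf Hf]].
- exists [:: i] => s' us' ss' h sh.
  rewrite (bigD1_seq i)//=; last by apply: ss'; rewrite inE.
  rewrite dote eqxx mulr1n mulrC big1 ?addr0// => j ji.
  by rewrite dote (negPf ji) mulr0n mulr0.
- exists (sf ++ sg) => s' us' ss' h sh.
  have spf := square_integrable_span pf; have spg := square_integrable_span pg.
  rewrite dotC dotDl// mulrDr (dotC f) (dotC g).
  rewrite (Hf s')//; last by move=> i ifs; apply: ss'; rewrite mem_cat ifs.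
  rewrite (Hg s')//; last by move=> i ifs; apply: ss'; rewrite mem_cat ifs orbT.
  rewrite -big_split/=; apply: eq_bigr => i _.
  by rewrite (dotC (e i) (fun x => f x + g x)) dotDl// (dotC f) (dotC g) mulrDr.
- exists sf => s' us' ss' h sh; have spf := square_integrable_span pf.
  rewrite dotC dotZl// mulrCA dotC (Hf s')// big_distrr/=; apply: eq_bigr => i _.
  by rewrite (dotC (e i) (fun x => c * f x)) dotZl// (dotC f) mulrCA.
Qed.

Lemma bessel f s : square_integrable f -> uniq s ->
  \sum_(i <- s) dot f (e i) ^+ 2 <= K * dot f f.
Proof.
move=> sf us.
(* The orthogonal projection of [f] on the span of the [e i], [i] in [s]: expanding
   [K * dot (f - p) (f - p) >= 0] leaves exactly the claim. *)
pose p x := \sum_(i <- s) (dot f (e i) / K) * e i x.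
have sp : square_integrable p.
  by apply: square_integrable_sum => i; exact: square_integrableZ.
have dp h : square_integrable h ->
    dot p h = \sum_(i <- s) (dot f (e i) / K) * dot (e i) h.
  exact: dot_suml.
have dpe i : i \in s -> dot (e i) p = dot f (e i).
  move=> si; rewrite dotC dp// (bigD1_seq i)//= dote eqxx mulr1n divfK ?gt_eqF//.
  rewrite big1 ?addr0// => j ji; by rewrite dote (negPf ji) mulr0.
have fp : K * dot f p = \sum_(i <- s) dot f (e i) ^+ 2.
  rewrite dotC dp// big_distrr/=; apply: eq_bigr => i _.
  by rewrite (dotC (e i)); field; rewrite gt_eqF.
have pp : K * dot p p = \sum_(i <- s) dot f (e i) ^+ 2.
  rewrite dp// big_distrr/= !big_seq; apply: eq_bigr => i si.
  by rewrite dpe//; field; rewrite gt_eqF.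
have := mulr_ge0 (ltW K0) (dot_ge0 (fun x => f x - p x)).
rewrite dot_subr// mulrDr mulrBr mulrCA fp pp; lra.
Qed.

(** Bessel bounds every finite partial sum. Conversely, a [p] of the span close to [f] has finitely
    many coordinates, and the partial sum over them already reaches [K * dot f f] up to [eps]. *)
Lemma parseval f : span_closure f ->
  (\esum_(i in [set: I]) (dot f (e i) ^+ 2)%:E)%E = (K * dot f f)%:E.
Proof.
move=> [sf cf]; apply/eqP; rewrite eq_le; apply/andP; split.
  apply: ge_ereal_sup => _ [A [finA _] <-].
  by rewrite fsbig_finite//= sumEFin lee_fin; exact: bessel.
apply/lee_addgt0Pr => eps eps0.
have [|p pp fp] := cf (eps / K); first by rewrite divr_gt0.
have [s Hs] := span_coord pp.
have sp := square_integrable_span pp.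
apply: (@le_trans _ _ ((\sum_(i <- undup s) dot f (e i) ^+ 2)%:E + eps%:E)%E).
  rewrite -EFinD lee_fin.
  have us := undup_uniq s.
  have ss i : i \in s -> i \in undup s by rewrite mem_undup.
  have := Hs _ us ss _ sf; have := Hs _ us ss _ sp.
  set A := \sum_(i <- _) _ => ppA; set B := \sum_(i <- _) _ => fpB.
  set C := \sum_(i <- _) _.
  (* [B] is [K * dot f p] and [A] is [K * dot p p]. Hence [2 * B - A <= C], while the choice of [p]
     gives [K * dot f f <= eps + 2 * B - A]. *)
  have : 0 <= \sum_(i <- undup s) (dot f (e i) - dot (e i) p) ^+ 2.
    by apply: sumr_ge0 => i _; rewrite sqr_ge0.
  have -> : \sum_(i <- undup s) (dot f (e i) - dot (e i) p) ^+ 2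
            = C - 2 * B + A.
    rewrite /A /B /C big_distrr/= -sumrB -big_split/=; apply: eq_bigr => i _.
    by rewrite (dotC p); ring.
  have := ler_wpM2l (ltW K0) fp.
  rewrite [K * (eps / K)]mulrC divfK ?gt_eqF// dot_subr// mulrDr mulrBr.
  by rewrite (mulrCA K) fpB ppA; lra.
apply: leeD => //; apply: esum_ge.
exists [set` undup s]; first by split.
rewrite fsbig_finite//=.
rewrite -sumEFin le_eqVlt; apply/orP; left; apply/eqP.
apply: perm_big; apply: uniq_perm; rewrite ?undup_uniq ?fset_uniq//.
move=> i; rewrite in_fset_set//.
by rewrite mem_setE.
Qed.

End Orthogonal.
End SquareIntegrable.

(** * Density of the span *)

Section Density.
Context d (T : measurableType d) (R : realType).
Variables (mu : {measure set T -> \bar R}) (D : set T).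
Hypothesis mD : measurable D.
Variables (I : choiceType) (e : I -> T -> R).
Hypothesis se : forall i, square_integrable mu D (e i).
Implicit Types f g h p : T -> R.

Lemma span_closure_span p : span e p -> span_closure mu D e p.
Proof.
move=> pp; split; first exact: (square_integrable_span mD se).
move=> eps /ltW eps0; exists p => //; rewrite /dot.
under eq_Rintegral do rewrite subrr mul0r.
by rewrite /Rintegral integral0.
Qed.

Lemma span_closureD f g : span_closure mu D e f -> span_closure mu D e g ->
  span_closure mu D e (fun x => f x + g x).
Proof.
move=> [sf cf] [sg cg]; split; first exact: square_integrableD.
(* Each of the two squared distances is doubled by [dot_addr_le], so a quarter of [eps] is allotted
   to each. *)
move=> eps eps0; have e4 : 0 < eps / 4 by rewrite divr_gt0.
have [p pp fp] := cf _ e4; have [q qq gq] := cg _ e4.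
have sp := square_integrable_span mD se pp.
have sq := square_integrable_span mD se qq.
exists (fun x => p x + q x); first exact: spanD.
have := dot_addr_le mD (square_integrableB mD sf sp) (square_integrableB mD sg sq).
set A := dot _ _ _ _ => Ale; set B := dot _ _ _ _.
have -> : B = A.
  by congr dot; apply/funext => x; rewrite opprD addrACA.
lra.
Qed.

Lemma span_closureZ c f : span_closure mu D e f ->
  span_closure mu D e (fun x => c * f x).
Proof.
move=> [sf cf]; split; first exact: square_integrableZ.
move=> eps eps0.
(* The added 1 keeps the divisor positive when [c] is zero. *)
have c0 : 0 < c ^+ 2 + 1 by have := sqr_ge0 c; lra.
have [|p pp fp] := cf (eps / (c ^+ 2 + 1)); first by rewrite divr_gt0.
have sp := square_integrable_span mD se pp.
have sfp := square_integrableB mD sf sp.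
exists (fun x => c * p x); first exact: spanZ.
have -> : dot mu D (fun x => c * f x - c * p x) (fun x => c * f x - c * p x) =
    c * (c * dot mu D (fun x => f x - p x) (fun x => f x - p x)).
  rewrite -dotZl// dotC -dotZl//; last exact: square_integrableZ.
  by congr dot; apply/funext => x; rewrite mulrBr.
rewrite ler_pdivlMr// in fp; apply: le_trans fp.
have := dot_ge0 mu D (fun x => f x - p x); rewrite expr2; nra.
Qed.

Lemma span_closure_sum (J : Type) (s : seq J) (F : J -> T -> R) :
  span_closure mu D e (cst 0) -> (forall j, span_closure mu D e (F j)) ->
  span_closure mu D e (fun x => \sum_(j <- s) F j x).
Proof.
move=> c0 cF; elim: s => [|j s IH].
  by under eq_fun do rewrite big_nil.
by under eq_fun do rewrite big_cons; exact: span_closureD.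
Qed.

(** Dominated convergence for [(f - f_ n) ^+ 2], with dominating function [(2 * g) ^+ 2], makes
    [f_ n] converge to [f] in the square norm; some [f_ n] close to [f] is then approximated in the
    span. Only values on [D] matter. *)
Lemma span_closure_dominated (f_ : nat -> T -> R) f g :
  (forall n, span_closure mu D e (f_ n)) ->
  measurable_fun setT f -> square_integrable mu D g ->
  (forall n x, D x -> `|f_ n x| <= g x) ->
  (forall x, D x -> f_ ^~ x @ \oo --> f x) ->
  span_closure mu D e f.
Proof.
move=> cf_ mf sg fg ff.
have fleg x : D x -> `|f x| <= g x.
  move=> Dx; have /cvg_norm cn := ff x Dx.
  rewrite -(cvg_lim _ cn)//; apply: limr_le.
    by apply/cvg_ex; exists `|f x|.
  by apply: nearW => n; exact: fg.
have sqrle x a : `|a| <= g x -> a ^+ 2 <= g x ^+ 2.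
  by move=> ag; rewrite -(real_normK (num_real a)) ler_pXn2r// nnegrE ?(le_trans _ ag).
have sf : square_integrable mu D f.
  by apply: (square_integrableW mD mf sg) => x Dx; apply: sqrle; exact: fleg.
split=> // eps eps0.
pose F n x := ((f x - f_ n x) ^+ 2)%:E.
have sfn n : square_integrable mu D (f_ n) by case: (cf_ n).
have cvgF : (fun n => \int[mu]_(x in D) F n x)%E @ \oo --> 0%E.
  have [|||||_ _] := @dominated_convergence _ _ _ mu D mD F (cst 0%E)
      (fun x => ((2 * g x) ^+ 2)%:E).
  - move=> n; apply: measurable_funTS; apply: measurable_sqr.
    by apply: measurable_funB => //; case: (sfn n).
  - exact: measurable_cst.
  - apply: aeW => x Dx; apply/fine_cvgP; split; first by exists 0%N.
    have cB : (fun n => f x - f_ n x) @ \oo --> f x - f x.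
      by apply: cvgB; [exact: cvg_cst|exact: ff].
    have /= := cvgM cB cB; rewrite subrr mul0r.
    by move=> cBB; exact: cBB.
  - by apply: square_integrable_sqr => //; exact: square_integrableZ.
  - apply: aeW => x n Dx; rewrite /F gee0_abs ?lee_fin ?sqr_ge0//.
    have fx := fleg _ Dx; have fnx := fg n _ Dx.
    have := ler_normB (f x) (f_ n x).
    rewrite -(real_normK (num_real (f x - f_ n x))) => h.
    have gx0 : 0 <= g x by apply: le_trans fx.
    by rewrite ler_pXn2r ?nnegrE ?normr_ge0 ?mulr_ge0//; lra.
  by rewrite integral0.
have e4 : 0 < eps / 4 by rewrite divr_gt0.
have [n Fn] : exists n, (\int[mu]_(x in D) F n x < (eps / 4)%:E)%E.
  have /fine_cvgP[fF] := cvgF.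
  move=> /cvgrPdist_lt /(_ _ e4) lF.
  have [n _ /(_ n (leqnn n))[ffn /= ltn]] := filterI fF lF.
  exists n; move: ltn; rewrite sub0r normrN => ltn.
  by rewrite -(fineK ffn) lte_fin (le_lt_trans (ler_norm _) ltn).
have [_ /(_ _ e4)[p pp fnp]] := cf_ n.
have sp := square_integrable_span mD se pp.
exists p => //.
have sffn := square_integrableB mD sf (sfn n).
have := dot_addr_le mD sffn (square_integrableB mD (sfn n) sp).
have : dot mu D (fun x => f x - f_ n x) (fun x => f x - f_ n x) < eps / 4.
  by rewrite -lte_fin EFin_dot.
set A := dot _ _ _ _ => Ale; set B := dot _ _ _ _ in fnp *; set C := dot _ _ _ _.
have -> : dot mu D (fun x => f x - p x) (fun x => f x - p x) = C.
  by congr dot; apply/funext => x; ring.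
lra.
Qed.

(** Dynkin's theorem: the sets whose indicator is in the closure are stable under complement, by
    subtraction from 1, and under countable disjoint union, by dominated convergence of the partial
    sums. *)
Lemma span_closure_indic (G : set (set T)) :
  @measurable _ T = <<s G >> -> setI_closed G ->
  span_closure mu D e (cst 1) ->
  (forall A, G A -> span_closure mu D e \1_A) ->
  forall A, measurable A -> span_closure mu D e \1_A.
Proof.
move=> GE GI c1 cG A; rewrite GE.
have s1 : square_integrable mu D (cst 1) by case: c1.
apply: (@dynkin_induction _ _ G (fun A => span_closure mu D e \1_A)) => //.
- by rewrite indicT.
- move=> S mS cS.
  suff -> : \1_(~` S) = (fun x => cst 1 x + -1 * \1_S x) :> (T -> R).
    by apply: span_closureD => //; exact: span_closureZ.
  apply/funext => x; rewrite !indicE in_setC mulN1r.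
  by case: (x \in S); rewrite /= ?subrr ?subr0.
- move=> F mF tF cF.
  (* By disjointness the partial sums at a point of [F k] jump once from 0 to 1, so they are bounded
     by 1 and eventually constant. *)
  have sumF x k : F k x -> forall n,
      \sum_(i < n) \1_(F i) x = (k < n)%N%:R :> R.
    move=> Fkx n; case: ltnP => [kn|nk].
      rewrite (bigD1 (Ordinal kn))//= indicE mem_set// big1 ?addr0// => i ik.
      rewrite indicE memNset// => Fix; move/negP: ik; apply; apply/eqP/val_inj.
      by apply: (tF i k) => //; exists x.
    rewrite big1// => i _; rewrite indicE memNset// => Fix.
    have ik : i = k :> nat by apply: (tF i k) => //; exists x.
    by have := ltn_ord i; rewrite ik ltnNge nk.
  have sumF0 x : ~ (\bigcup_k F k) x -> forall n,
      \sum_(i < n) \1_(F i) x = 0 :> R.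
    move=> Fx n; apply: big1 => i _; rewrite indicE memNset// => Fix.
    by apply: Fx; exists i.
  apply: (@span_closure_dominated (fun n x => \sum_(i < n) \1_(F i) x) _ (cst 1)) => //.
  + move=> n; apply: span_closure_sum => //.
    suff -> : cst 0 = (fun x => 0 * cst 1 x) :> (T -> R).
      exact: span_closureZ.
    by apply/funext => x; rewrite mul0r.
  + by apply: measurable_indic; exact: bigcup_measurable.
  + move=> n x Dx; have [[k _ Fkx]|Fx] := pselect ((\bigcup_k F k) x).
      by rewrite (sumF _ k)//; case: ltnP; rewrite /= ?normr1 ?normr0.
    by rewrite sumF0// normr0.
  + move=> x Dx; have [[k _ Fkx]|Fx] := pselect ((\bigcup_k F k) x).
      rewrite indicE mem_set; last by exists k.
      apply: cvg_near_cst; exists k.+1 => // n /= kn.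
      by rewrite (sumF _ k)// kn.
    rewrite indicE memNset//; apply: cvg_near_cst; apply: nearW => n.
    by rewrite sumF0.
Qed.

Import HBNNSimple.

Lemma span_closure_nnsfun (f : {nnsfun T >-> R}) :
  (forall A, measurable A -> span_closure mu D e \1_A) ->
  span_closure mu D e f.
Proof.
move=> cA.
have -> : (f : T -> R) = (fun x =>
    \sum_(y <- fset_set (range f)) y * \1_(f @^-1` [set y]) x).
  by apply/funext => x; rewrite fimfunE fsbig_finite.
apply: span_closure_sum; last first.
  by move=> y; apply: span_closureZ; apply: cA; exact: measurable_funPTI.
by have := cA set0 measurable0; rewrite indic0.
Qed.

(** A nonnegative function is the limit of an increasing sequence of simple functions, which it
    dominates itself; the general case splits [f] into positive and negative parts. *)
Lemma span_closure_full f :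
  (forall A, measurable A -> span_closure mu D e \1_A) ->
  square_integrable mu D f -> span_closure mu D e f.
Proof.
move=> cA sf; have mf : measurable_fun setT f by case: sf.
have pos h : (forall x, 0 <= h x) -> square_integrable mu D h ->
    span_closure mu D e h.
  move=> h0 sh; have mh : measurable_fun setT h by case: sh.
  have mEh : measurable_fun setT (EFin \o h) by exact/measurable_EFinP.
  pose h_ := nnsfun_approx measurableT mEh.
  have h_h x : (h_ ^~ x) @ \oo --> h x.
    have : EFin \o h_ ^~ x @ \oo --> (EFin \o h) x.
      by apply: cvg_nnsfun_approx => // y _; rewrite lee_fin.
    by move=> /fine_cvgP[].
  apply: (@span_closure_dominated (fun n => h_ n) h h) => //.
    by move=> n; exact: span_closure_nnsfun.
  move=> n x _; rewrite ger0_norm//.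
  rewrite -(cvg_lim _ (h_h x))//; apply: nondecreasing_cvgn_le.
    by move=> m m' mm'; exact/lefP/nd_nnsfun_approx.
  by apply/cvg_ex; exists (h x).
have spos h : square_integrable mu D h ->
    square_integrable mu D (fun x => Order.max (h x) 0).
  move=> sh; apply: (square_integrableW mD _ sh).
    by apply: measurable_maxr => //; case: sh.
  by move=> x _; case: (leP (h x) 0) => // _; rewrite expr0n sqr_ge0.
have sN : square_integrable mu D (fun x => - f x).
  by have := square_integrableZ mD (-1) sf; under eq_fun do rewrite mulN1r.
suff -> : f = (fun x => Order.max (f x) 0 + -1 * Order.max (- f x) 0).
  apply: span_closureD; last apply: span_closureZ.
    by apply: pos; [move=> x; rewrite le_max lexx orbT|exact: spos].
  by apply: pos; [move=> x; rewrite le_max lexx orbT|exact: spos].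
apply/funext => x; rewrite mulN1r.
by case: (leP (f x) 0) => fx; case: (leP (- f x) 0) => fx'; lra.
Qed.

End Density.

(** * Trigonometric polynomials *)

Section Periodicity.
Variable R : realType.
Implicit Types (x : R) (m : int).

Lemma sinD2pi_int x m : sin (x + m%:~R * (2 * pi)) = sin x.
Proof.
have nat_case (y : R) n : sin (y + n%:R * (2 * pi)) = sin y.
  have /= <- := periodicn (@sinD2pi R) n y.
  by congr sin; rewrite !mulr_natl.
case: m => n; first exact: nat_case.
rewrite NegzE mulrNz mulNr -[LHS](nat_case _ n.+1).
by congr sin; rewrite subrK.
Qed.

Lemma cosD2pi_int x m : cos (x + m%:~R * (2 * pi)) = cos x.
Proof. by rewrite -!sinDpihalf addrAC sinD2pi_int. Qed.

End Periodicity.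

(** * The orthogonal family [cas] and the algebra of trigonometric polynomials *)

Section Hartley.
Variable R : realType.
Implicit Types (m l : int) (t x : R).

Local Notation mu := (@lebesgue_measure R).
Local Notation D := (`[0, 2 * pi[%classic : set R).

(** The kernel of the Hartley transform, a real counterpart of the complex exponential of frequency
    [m]. *)
Definition cas m t : R := cos (m%:~R * t) + sin (m%:~R * t).

Lemma measurable_cosM (c : R) : measurable_fun setT (fun t : R => cos (c * t)).
Proof.
apply: continuous_measurable_fun => t; apply: continuous_comp.
  by apply: cvgM; [exact: cvg_cst|exact: cvg_id].
exact: continuous_cos.
Qed.

Lemma measurable_sinM (c : R) : measurable_fun setT (fun t : R => sin (c * t)).
Proof.
apply: continuous_measurable_fun => t; apply: continuous_comp.
  by apply: cvgM; [exact: cvg_cst|exact: cvg_id].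
exact: continuous_sin.
Qed.

Lemma measurable_period : measurable (D : set (measurableTypeR R)).
Proof. exact: measurable_itv. Qed.

Lemma lebesgue_measure_period : mu D = (2 * pi)%:E.
Proof.
rewrite lebesgue_measure_itv/= lte_fin mulr_gt0 ?pi_gt0//.
by rewrite sube0.
Qed.

Lemma square_integrable_bounded (f : R -> R) (M : R) : measurable_fun setT f ->
  (forall t, D t -> `|f t| <= M) -> square_integrable mu D f.
Proof.
move=> mf fM; apply: (@square_integrableW _ _ _ _ _ _ _ (cst M)) => //.
  split; first exact: measurable_cst.
  have -> : (\int[mu]_(x in D) (cst M x ^+ 2)%:E = (M ^+ 2)%:E * mu D)%E.
    by rewrite -integral_cst.
  by rewrite lebesgue_measure_period -EFinM ltry.
move=> t Dt; have ft := fM t Dt.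
rewrite -(real_normK (num_real (f t))) ler_pXn2r ?nnegrE ?normr_ge0//.
exact: le_trans ft.
Qed.

Lemma square_integrable_cos (c : R) :
  square_integrable mu D (fun t => cos (c * t)).
Proof.
apply: (@square_integrable_bounded _ 1); first exact: measurable_cosM.
by move=> t _; rewrite ler_norml cos_geN1 cos_le1.
Qed.

Lemma square_integrable_sin (c : R) :
  square_integrable mu D (fun t => sin (c * t)).
Proof.
apply: (@square_integrable_bounded _ 1); first exact: measurable_sinM.
by move=> t _; rewrite ler_norml sin_geN1 sin_le1.
Qed.

Lemma square_integrable_cas m : square_integrable mu D (cas m).
Proof.
apply: square_integrableD => //; first exact: square_integrable_cos.
exact: square_integrable_sin.
Qed.

Lemma Rintegral_derive (F f : R -> R) : continuous f ->
  (forall t, is_derive t 1 F (f t)) -> mu.-integrable D (EFin \o f) ->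
  \int[mu]_(t in D) f t = F (2 * pi) - F 0.
Proof.
move=> cf dF intf; rewrite Rintegral_itv_bndo_bndc//.
have dbF t : derivable F t 1 by apply: ex_derive; exact: dF.
have cF : continuous F.
  by move=> t; apply/differentiable_continuous/derivable1_diffP.
rewrite /Rintegral (@continuous_FTC2 _ f F)//.
- by rewrite mulr_gt0 ?pi_gt0.
- exact: continuous_subspaceT.
- split=> [t _||]; first exact: dbF.
    by apply: cvg_at_right_filter; exact: cF.
  by apply: cvg_at_left_filter; exact: cF.
- by move=> t _; rewrite derive1E; apply: derive_val; exact: dF.
Qed.

Lemma integrable_period (f : R -> R) : square_integrable mu D f ->
  mu.-integrable D (EFin \o f).
Proof.
(* The constant 1, written as a cosine of frequency 0: on a period of finite measure, square
   integrable functions are integrable. *)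
move=> sf; have s1 : square_integrable mu D (fun t => cos (0 * t)).
  exact: square_integrable_cos.
have := integrable_dot measurable_period sf s1.
by apply: eq_integrable => // t _; rewrite mul0r cos0 mulr1.
Qed.

Lemma Rintegral_cos_int m :
  \int[mu]_(t in D) cos (m%:~R * t) = 2 * pi *+ (m == 0).
Proof.
have [->|m0] := eqVneq m 0.
  under eq_Rintegral do rewrite mul0r cos0.
  by rewrite Rintegral_cst//= lebesgue_measure_period mul1r.
have m0' : m%:~R != 0 :> R by rewrite intr_eq0.
have dF t : is_derive t 1 (fun t => m%:~R^-1 * sin (m%:~R * t)) (cos (m%:~R * t)).
  apply: is_derive_eq.
  by rewrite /GRing.scale/=; field.
rewrite (Rintegral_derive _ dF).
- by rewrite -[m%:~R * (2 * pi)]add0r sinD2pi_int mulr0 sin0 mulr0 subrr.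
- move=> t; apply: continuous_comp; last exact: continuous_cos.
  by apply: cvgM; [exact: cvg_cst|exact: cvg_id].
- by apply: integrable_period; exact: square_integrable_cos.
Qed.

Lemma Rintegral_sin_int m : \int[mu]_(t in D) sin (m%:~R * t) = 0.
Proof.
have [->|m0] := eqVneq m 0.
  under eq_Rintegral do rewrite mul0r sin0.
  by rewrite Rintegral_cst//= mul0r.
have m0' : m%:~R != 0 :> R by rewrite intr_eq0.
have dF t : is_derive t 1 (fun t => - m%:~R^-1 * cos (m%:~R * t)) (sin (m%:~R * t)).
  apply: is_derive_eq.
  by rewrite /GRing.scale/=; field.
rewrite (Rintegral_derive _ dF).
- by rewrite -[m%:~R * (2 * pi)]add0r cosD2pi_int mulr0 subrr.
- move=> t; apply: continuous_comp; last exact: continuous_sin.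
  by apply: cvgM; [exact: cvg_cst|exact: cvg_id].
- by apply: integrable_period; exact: square_integrable_sin.
Qed.

(** The subtraction formula for the cosine and the addition formula for the sine. This gives both
    the orthogonality of the family and the stability of its span under products. *)
Lemma casM m l t :
  cas m t * cas l t = cos ((m - l)%:~R * t) + sin ((m + l)%:~R * t).
Proof.
have -> : (m - l)%:~R * t = m%:~R * t - l%:~R * t by rewrite rmorphB/= mulrBl.
have -> : (m + l)%:~R * t = m%:~R * t + l%:~R * t by rewrite rmorphD/= mulrDl.
rewrite /cas cosB sinD; ring.
Qed.

Lemma dot_cas m l : dot mu D (cas m) (cas l) = 2 * pi *+ (m == l).
Proof.
rewrite /dot; under eq_Rintegral do rewrite casM.
rewrite RintegralD//=.
- by rewrite Rintegral_cos_int Rintegral_sin_int addr0 subr_eq0.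
- by apply: integrable_period; exact: square_integrable_cos.
- by apply: integrable_period; exact: square_integrable_sin.
Qed.

(** The cosine is the part of [cas] that is even in [m], and the sine the odd part. *)
Lemma cos_cas m t : cos (m%:~R * t) = 2^-1 * cas m t + 2^-1 * cas (- m) t.
Proof. by rewrite /cas rmorphN/= (mulNr m%:~R) cosN sinN; field. Qed.

Lemma sin_cas m t : sin (m%:~R * t) = 2^-1 * cas m t + - 2^-1 * cas (- m) t.
Proof. by rewrite /cas rmorphN/= (mulNr m%:~R) cosN sinN; field. Qed.

Lemma span_cos m : span cas (fun t => cos (m%:~R * t)).
Proof.
under eq_fun do rewrite cos_cas.
by apply: spanD; apply: spanZ; exact: span_base.
Qed.

Lemma span_sin m : span cas (fun t => sin (m%:~R * t)).
Proof.
under eq_fun do rewrite sin_cas.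
by apply: spanD; apply: spanZ; exact: span_base.
Qed.

Lemma span_cst (c : R) : span cas (fun=> c).
Proof.
suff -> : (fun=> c) = (fun t => c * cas 0 t).
  by apply: spanZ; exact: span_base.
by apply/funext => t; rewrite /cas mul0r cos0 sin0 addr0 mulr1.
Qed.

(** Induction on both factors reduces to [casM]. Trigonometric polynomials thus form an algebra, so
    polynomials can be composed with them. *)
Lemma spanM p q : span cas p -> span cas q -> span cas (fun t => p t * q t).
Proof.
move=> pp; elim: pp q => [m|f g _ IHf _ IHg|c f _ IHf] q pq.
- elim: pq => [l|f g _ IHf _ IHg|c f _ IHf].
  + under eq_fun do rewrite casM.
    by apply: spanD; [exact: span_cos|exact: span_sin].
  + by under eq_fun do rewrite mulrDr; exact: spanD.
  + by under eq_fun do rewrite mulrCA; exact: spanZ.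
- by under eq_fun do rewrite mulrDl; apply: spanD; [exact: IHf|exact: IHg].
- by under eq_fun do rewrite -mulrA; apply: spanZ; exact: IHf.
Qed.

End Hartley.

(** * Polynomial approximation of the sign function on [[-1, 1]] *)

Section SignApproximation.
Variable R : realType.
Implicit Types x y : R.

(** The Newton-Schulz iteration for the sign: an odd cubic whose fixed points are -1, 0 and 1. *)
Definition sgn_step x : R := (3 * x - x ^+ 3) / 2.

Lemma sgn_stepN x : sgn_step (- x) = - sgn_step x.
Proof. by rewrite /sgn_step; field. Qed.

Lemma iter_sgn_stepN n x : iter n sgn_step (- x) = - iter n sgn_step x.
Proof. by elim: n => //= n ->; rewrite sgn_stepN. Qed.

Lemma iter_sgn_step_bounds n x : 0 < x <= 1 ->
  x <= iter n sgn_step x <= 1 /\ 1 - iter n sgn_step x <= (1 - x / 2) ^+ n.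
Proof.
move=> /andP[x0 x1]; elim: n => [|n [/andP[IHx IH1] IH]] /=.
  by rewrite lexx expr0 x1; split=> //; lra.
set y := iter n sgn_step x in IHx IH1 IH *.
(* The distance to 1 is multiplied by a factor at most [1 - y / 2], hence at most [1 - x / 2]
   because the iterates stay above [x]: the decay is geometric. *)
have yE : 1 - sgn_step y = (1 - y) * ((2 - y - y ^+ 2) / 2).
  by rewrite /sgn_step; field.
have y2 : 0 <= y ^+ 2 <= 1.
  by rewrite sqr_ge0/= expr_le1//; lra.
have c0 : 0 <= (2 - y - y ^+ 2) / 2 by lra.
have c1 : (2 - y - y ^+ 2) / 2 <= 1 - x / 2 by lra.
have y10 : 0 <= 1 - y by lra.
split; last first.
  by rewrite yE (exprSr (1 - x / 2)); apply: ler_pM.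
have -> /= : sgn_step y <= 1 by rewrite -subr_ge0 yE mulr_ge0.
rewrite andbT; suff : 1 - sgn_step y <= 1 - y by lra.
rewrite yE; nra.
Qed.

Lemma norm_iter_sgn_step n x : `|x| <= 1 -> `|iter n sgn_step x| <= 1.
Proof.
rewrite !ler_norml => /andP[xN1 x1].
have [x0|x0|->] := ltgtP x 0.
- have [|+ _] := @iter_sgn_step_bounds n (- x); first by lra.
  by rewrite iter_sgn_stepN; lra.
- have [|/andP[? ?] _] := @iter_sgn_step_bounds n x; first by lra.
  by lra.
- have -> : iter n sgn_step 0 = 0 :> R.
    by elim: n => //= n ->; rewrite /sgn_step mulr0 expr0n/= subr0 mul0r.
  by lra.
Qed.

(** For positive [x] the iterates are squeezed between [1 - (1 - x / 2) ^+ n] and 1; oddness gives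
    the negative case, and 0 is fixed. *)
Lemma cvg_iter_sgn_step x : `|x| <= 1 ->
  (fun n => iter n sgn_step x) @ \oo --> Num.sg x.
Proof.
have pos y : 0 < y <= 1 -> (fun n => iter n sgn_step y) @ \oo --> (1 : R).
  move=> y01; apply: (@squeeze_cvgr _ _ _ _ (fun n => 1 - (1 - y / 2) ^+ n) (cst 1)).
  - apply: nearW => n; have [/andP[_ ->] h] := iter_sgn_step_bounds n y01.
    by rewrite andbT; lra.
  - rewrite -[X in _ --> X]subr0; apply: cvgB; first exact: cvg_cst.
    apply: cvg_expr; rewrite ger0_norm; move/andP: y01 => []; lra.
  - exact: cvg_cst.
rewrite ler_norml => /andP[xN1 x1].
have [x0|x0|->] := ltgtP x 0.
- have -> : (fun n => iter n sgn_step x) = (fun n => - iter n sgn_step (- x)).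
    by apply/funext => n; rewrite iter_sgn_stepN opprK.
  by rewrite ltr0_sg//; apply: cvgN; apply: pos; lra.
- by rewrite gtr0_sg//; apply: pos; rewrite x0.
- rewrite sgr0; apply: cvg_near_cst; apply: nearW => n.
  by elim: n => //= n ->; rewrite /sgn_step mulr0 expr0n/= subr0 mul0r.
Qed.

End SignApproximation.

(** * Completeness of the family [cas] on the period *)

Section Completeness.
Variable R : realType.
Implicit Types (t x : R).

Local Notation mu := (@lebesgue_measure R).
Local Notation D := (`[0, 2 * pi[%classic : set R).

Lemma span_iter_sgn_step (p : R -> R) n : span (@cas R) p ->
  span (@cas R) (fun t => iter n (@sgn_step R) (p t)).
Proof.
move=> pp; elim: n => //= n IH.
have -> : (fun t => sgn_step (iter n (@sgn_step R) (p t))) =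
    (fun t => 3 / 2 * iter n (@sgn_step R) (p t) + - 2^-1 *
      (iter n (@sgn_step R) (p t) *
       (iter n (@sgn_step R) (p t) * iter n (@sgn_step R) (p t)))).
  by apply/funext => t; rewrite /sgn_step; field.
apply: spanD; apply: spanZ => //; apply: spanM => //; exact: spanM.
Qed.

(* [sin (t / 2) * sin ((t - x) / 2)] is a trigonometric polynomial in [t] whose
   sign on the period is that of [t - x], except at [t = 0]. *)
Definition half_angle x t : R := sin (t / 2) * sin ((t - x) / 2).

(** The product equals [(cos (x / 2) - cos (t - x / 2)) / 2]: the half angles in [t] combine into
    frequency 1. *)
Lemma span_half_angle x : span (@cas R) (half_angle x).
Proof.
have -> : half_angle x = (fun t => cos (x / 2) / 2 +
    (- (cos (x / 2) / 2) * cos (1%:~R * t) + - (sin (x / 2) / 2) * sin (1%:~R * t))).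
  apply/funext => t; rewrite /half_angle.
  have -> : 1%:~R * t = t / 2 + t / 2 by rewrite mul1r; field.
  have -> : (t - x) / 2 = t / 2 - x / 2 by field.
  rewrite sinB cosD sinD.
  have := cos2Dsin2 (t / 2); set c := cos (t / 2); set s := sin (t / 2) => cs.
  have c2 : c * c = 1 - s * s by rewrite -!expr2 -cs addrK.
  by rewrite c2; field.
apply: spanD; first exact: span_cst.
by apply: spanD; apply: spanZ; [exact: span_cos|exact: span_sin].
Qed.

Lemma half_angle_le1 x t : `|half_angle x t| <= 1.
Proof.
rewrite normrM -[leRHS]mulr1.
by apply: ler_pM; rewrite // ler_norml sin_geN1 sin_le1.
Qed.

(** The polynomial [(s ^+ 2 + s) / 2] sends the signs -1, 0, 1 to 0, 0, 1. There is no exceptional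
    point: at [t = 0] and at [t = x] the sign is 0, and neither point lies in the open ray. *)
Lemma sg_half_angle x t : 0 <= x -> x < 2 * pi -> D t ->
  (Num.sg (half_angle x t) ^+ 2 + Num.sg (half_angle x t)) / 2 =
  \1_(`]x, +oo[%classic) t.
Proof.
move=> x0 x2; rewrite /= in_itv/= => /andP[t0 t2].
have pi0 := @pi_gt0 R.
rewrite indicE mem_setE in_itv/= andbT.
have [->|tn0] := eqVneq t 0.
  by rewrite /half_angle mul0r sin0 mul0r sgr0 expr0n/= addr0 mul0r ltNge x0.
have tpos : 0 < t by rewrite lt_neqAle eq_sym tn0.
have st : 0 < sin (t / 2).
  by apply: sin_gt0_pi; rewrite divr_gt0//= ltr_pdivrMr// mulrC.
rewrite /half_angle sgrM (gtr0_sg st) mul1r.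
have [xt|tx|->] := ltgtP x t.
- rewrite gtr0_sg; first by rewrite expr1n /=; field.
  by apply: sin_gt0_pi; lra.
- rewrite ltr0_sg; first by rewrite sqrrN expr1n subrr mul0r.
  rewrite -oppr_gt0 -sinN; apply: sin_gt0_pi; lra.
- by rewrite subrr mul0r sin0 sgr0 expr0n/= addr0 mul0r.
Qed.

Let se := @square_integrable_cas R.

Lemma span_closure_ray x : span_closure mu D (@cas R) \1_(`]x, +oo[%classic).
Proof.
have mind : measurable_fun [set: measurableTypeR R]
    (\1_(`]x, +oo[%classic) : R -> R).
  by apply: measurable_indic; exact: measurable_itv.
have s1 : square_integrable mu D (cst 1).
  apply: (@square_integrable_bounded _ _ 1) => //.
  by move=> t _; rewrite normr1.
(* If [x] is outside the period, the indicator is constant on it. The constant sequence in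
   [span_closure_dominated] passes from the constant to a function that agrees with it on [D]
   only. *)
have triv (c : R) : `|c| <= 1 -> (forall t, D t -> \1_(`]x, +oo[%classic) t = c) ->
    span_closure mu D (@cas R) \1_(`]x, +oo[%classic).
  move=> c1 xc; have := @span_closure_dominated _ (measurableTypeR R) R mu D
      (@measurable_period R) int (@cas R) se (fun _ _ => c)
      \1_(`]x, +oo[%classic) (cst 1).
  apply=> //.
  - move=> n; apply: span_closure_span => //. exact: span_cst.
  - by move=> t Dt; rewrite xc//; exact: cvg_cst.
have [x0|x0] := ltP x 0.
  apply: (@triv 1); rewrite ?normr1// => t /=; rewrite in_itv/= => /andP[t0 _].
  by rewrite indicE mem_set//= in_itv/= andbT (lt_le_trans x0).
have [x2|x2] := ltP x (2 * pi); last first.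
  apply: (@triv 0); rewrite ?normr0// => t /=; rewrite in_itv/= => /andP[_ t2].
  rewrite indicE memNset//= in_itv/= andbT; apply/negP.
  by rewrite -leNgt ltW// (lt_le_trans t2).
(* The trigonometric polynomials [(s n ^+ 2 + s n) / 2] stay in [[-1, 1]] and tend to the indicator
   on the period. *)
pose s n t := iter n (@sgn_step R) (half_angle x t).
have sp n : span (@cas R) (s n) by apply: span_iter_sgn_step; exact: span_half_angle.
apply: (@span_closure_dominated _ _ _ _ _ (@measurable_period R) _ _ se
    (fun n t => 2^-1 * (s n t * s n t + s n t)) _ (cst 1)) => //.
- move=> n; apply: span_closure_span => //.
  by apply: spanZ; apply: spanD => //; exact: spanM.
- move=> n t _; have := norm_iter_sgn_step n (half_angle_le1 x t).
  rewrite -/(s n t) => s1n; have s2n : s n t * s n t <= 1.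
    by rewrite -expr2 -(real_normK (num_real (s n t))) expr_le1.
  have := sqr_ge0 (s n t); rewrite expr2; move: s1n.
  by rewrite /= !ler_norml => /andP[? ?] ?; lra.
- move=> t Dt; rewrite -sg_half_angle// mulrC.
  have cs := cvg_iter_sgn_step (half_angle_le1 x t).
  apply: cvgM; first exact: cvg_cst.
  by apply: cvgD => //; rewrite expr2; exact: cvgM.
Qed.

(** Open rays to the right generate the Borel sets, and two of them intersect in the ray starting at
    the larger endpoint. *)
Lemma span_closure_cas (f : R -> R) : square_integrable mu D f ->
  span_closure mu D (@cas R) f.
Proof.
apply: (@span_closure_full _ _ _ _ _ (@measurable_period R) _ _ se).
apply: (@span_closure_indic _ _ _ _ _ (@measurable_period R) _ _ se (@RGenOInfty.G R)).
- exact: RGenOInfty.measurableE.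
- move=> _ _ [x ->] [y ->]; exists (Order.max x y); apply/seteqP.
  by split=> t /=; rewrite !in_itv/= !andbT gt_max => /andP.
- apply: (@span_closure_span _ _ _ _ _ (@measurable_period R) _ _ se).
  exact: span_cst.
- by move=> _ [x ->]; exact: span_closure_ray.
Qed.

Lemma parseval_cas (f : R -> R) : square_integrable mu D f ->
  (\esum_(m in [set: int]) (dot mu D f (cas m) ^+ 2)%:E)%E =
  (2 * pi * dot mu D f f)%:E.
Proof.
move=> sf; apply: (parseval (@measurable_period R) _ se).
- by rewrite mulr_gt0 ?pi_gt0.
- exact: dot_cas.
- exact: span_closure_cas.
Qed.

End Completeness.

(** * Sums over the integers *)

Section IntegerSums.
Local Open Scope ereal_scope.

(** The enumeration 0, -1, 1, -2, ... of the integers, which turns sums over [int] into series,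
    where measurability and monotone convergence apply. *)
Definition int_of_enum (n : nat) : int := if odd n then Negz n./2 else Posz n./2.

Lemma int_of_enum_bij : set_bij [set: nat] [set: int] int_of_enum.
Proof.
split => [//|m n _ _|[k|k] _].
- rewrite /int_of_enum => mn; rewrite -(odd_double_half m) -(odd_double_half n).
  by move: mn; case: (odd m); case: (odd n) => // -[->].
- by exists k.*2 => //; rewrite /int_of_enum odd_double doubleK.
- by exists k.*2.+1 => //; rewrite /int_of_enum /= odd_double/= uphalf_double.
Qed.

Lemma esum_int_nneseries (R : realType) (a : int -> \bar R) :
  (forall m, 0 <= a m) ->
  \esum_(m in [set: int]) a m = \sum_(n <oo) a (int_of_enum n).
Proof.
by move=> a0; rewrite (@reindex_esum _ _ _ _ _ _ _ int_of_enum_bij) nneseries_esumT.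
Qed.

Section Integral.
Context d (T : measurableType d) (R : realType).
Variables (mu : {measure set T -> \bar R}) (D : set T).
Hypothesis mD : measurable D.
Variable h : int -> T -> \bar R.
Hypothesis mh : forall m, measurable_fun setT (h m).
Hypothesis h0 : forall m t, 0 <= h m t.

Lemma measurable_esum_int :
  measurable_fun setT (fun t => \esum_(m in [set: int]) h m t).
Proof.
under eq_fun do rewrite esum_int_nneseries//.
by apply: (@ge0_emeasurable_sum _ _ _ _ (fun n => h (int_of_enum n)) xpredT).
Qed.

Lemma integral_esum_int :
  \int[mu]_(t in D) (\esum_(m in [set: int]) h m t) =
  \esum_(m in [set: int]) \int[mu]_(t in D) h m t.
Proof.
rewrite esum_int_nneseries; last by move=> m; exact: integral_ge0.
under eq_integral do rewrite esum_int_nneseries//.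
by rewrite integral_nneseries// => n; exact: measurable_funTS.
Qed.

End Integral.

Variable R : realType.
Implicit Types a b : int -> \bar R.

Lemma esum_int_shift (l : int) a :
  \esum_(m in [set: int]) a (m + l)%R = \esum_(m in [set: int]) a m.
Proof.
rewrite [RHS](@reindex_esum _ _ _ setT setT (+%R^~ l))//.
split=> // [m m' _ _|m _]; first exact: addIr.
by exists (m - l)%R; rewrite ?subrK.
Qed.

Lemma esum_int_opp a :
  \esum_(m in [set: int]) a (- m)%R = \esum_(m in [set: int]) a m.
Proof.
by rewrite [RHS](@reindex_esum _ _ _ setT setT -%R).
Qed.

(** Adding each sum to its image under [m -> - m] shows that the doubled sums agree. *)
Lemma esum_int_symm a b : (forall m, 0 <= a m) -> (forall m, 0 <= b m) ->
  (forall m, a m + a (- m)%R = b m + b (- m)%R) ->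
  \esum_(m in [set: int]) a m = \esum_(m in [set: int]) b m.
Proof.
move=> a0 b0 ab.
have double (c : int -> \bar R) : (forall m, 0 <= c m) -> \esum_(m in [set: int]) c m +
    \esum_(m in [set: int]) c m = \esum_(m in [set: int]) (c m + c (- m)%R).
  by move=> c0; rewrite esumD// esum_int_opp.
have : \esum_(m in [set: int]) a m + \esum_(m in [set: int]) a m =
       \esum_(m in [set: int]) b m + \esum_(m in [set: int]) b m.
  by rewrite !double//; apply: eq_esum.
(* Halving in the extended reals: nonnegativity excludes -oo, and the finite and infinite cases
   remain. *)
have : 0 <= \esum_(m in [set: int]) a m by exact: esum_ge0.
have : 0 <= \esum_(m in [set: int]) b m by exact: esum_ge0.
case: (\esum_(m in _) a m) => [x| |]; case: (\esum_(m in _) b m) => [y| |] //=.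
by move=> _ _; rewrite -!EFinD => -[xy]; congr EFin; lra.
Qed.

Lemma esum_intZl (c : R) a : (0 <= c)%R -> (forall m, 0 <= a m) ->
  \esum_(m in [set: int]) (c%:E * a m) = c%:E * \esum_(m in [set: int]) a m.
Proof.
move=> c0 a0; rewrite !esum_int_nneseries//.
  by rewrite nneseriesZl.
by move=> m; rewrite mule_ge0// lee_fin.
Qed.

End IntegerSums.

(** * Translation and periodization *)

Section Translation.
Variable R : realType.
Local Notation mu := (@lebesgue_measure R).
Local Notation D := (`[0, 2 * pi[%classic : set R).
Implicit Types (c s t : R) (m : int).

Lemma measurable_addr c : measurable_fun setT (fun t : R => t + c).
Proof.
by apply: measurable_funD; [exact: measurable_id|exact: measurable_cst].
Qed.

(** The pushforward agrees with Lebesgue measure on half-open intervals, and these determine it. *)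
Lemma lebesgue_measure_addr c (A : set R) : measurable A ->
  pushforward mu ((fun t => t + c) : _ -> measurableTypeR R) A = mu A.
Proof.
move=> mA; apply/esym/lebesgue_measure_unique => //=.
  exact: measurable_addr.
move=> _ _ [[a b]] _ <-.
rewrite /pushforward.
have -> : ((fun t => t + c) : _ -> measurableTypeR R) @^-1` `]a, b]%classic =
    `]a - c, b - c]%classic.
  by apply/seteqP; split=> t; rewrite /preimage/= !in_itv/= ltrBlDr lerBrDr.
by rewrite !lebesgue_measure_itv/= !lte_fin ltrD2r -!EFinB opprB addrA subrK.
Qed.

Lemma ge0_integral_addr (f : R -> \bar R) c : measurable_fun setT f ->
  (forall t, 0 <= f t)%E ->
  (\int[mu]_t f (t + c)%R = \int[mu]_t f t)%E.
Proof.
move=> mf f0.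
have ma : measurable_fun setT
    ((fun t => t + c) : measurableTypeR R -> measurableTypeR R).
  exact: measurable_addr.
have := ge0_integral_pushforward ma mu measurableT mf (fun t _ => f0 t).
rewrite preimage_setT => <-.
by apply: eq_measure_integral => // A mA _; exact: lebesgue_measure_addr.
Qed.

Lemma Rintegral_addr (f : R -> R) c : measurable_fun setT f ->
  \int[mu]_t f (t + c) = \int[mu]_t f t.
Proof.
move=> mf; have mEf : measurable_fun setT (EFin \o f) by exact/measurable_EFinP.
rewrite /Rintegral [in RHS]integralE [in LHS]integralE.
congr (fine (_ - _)%E).
  transitivity (\int[mu]_t ((EFin \o f)^\+ (t + c)%R))%E.
    by apply: eq_integral => t _; rewrite !funeposE.
  by apply: ge0_integral_addr => //; exact: measurable_funepos.
transitivity (\int[mu]_t ((EFin \o f)^\- (t + c)%R))%E.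
  by apply: eq_integral => t _; rewrite !funenegE.
by apply: ge0_integral_addr => //; exact: measurable_funeneg.
Qed.

Definition samples (f : R -> R) s m : R := f (s + m%:~R * (2 * pi)).

Lemma measurable_samples (f : R -> R) m : measurable_fun setT f ->
  measurable_fun setT (fun s => samples f s m).
Proof. by move=> mf; apply: measurableT_comp => //; exact: measurable_addr. Qed.

(** The translates of the period by multiples of [2 * pi] tile the line; the floor selects the tile
    containing [t]. *)
Lemma period_shiftP m t :
  D (t - m%:~R * (2 * pi)) <-> Num.floor (t / (2 * pi)) = m.
Proof.
have pi2 : 0 < 2 * pi :> R by rewrite mulr_gt0 ?pi_gt0.
rewrite /= in_itv/= subr_ge0 ltrBlDl -ler_pdivlMr// -[X in _ + X]mul1r -mulrDl.
rewrite -ltr_pdivrMr//; split=> [tm|<-].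
  by apply: floor_def; rewrite rmorphD.
by have := floor_itv (t / (2 * pi)); rewrite rmorphD.
Qed.

(** The integrand is split along the tiles, sum and integral are exchanged, and each tile is
    translated back to the period. *)
Lemma integral_periodize (f : R -> \bar R) : measurable_fun setT f ->
  (forall t, 0 <= f t)%E ->
  (\int[mu]_t f t =
   \int[mu]_(s in D) (\esum_(m in [set: int]) f (s + m%:~R * (2 * pi))%R))%E.
Proof.
move=> mf f0.
have mfs (m : int) : measurable_fun setT (fun s => f (s + m%:~R * (2 * pi))).
  by apply: measurableT_comp => //; exact: measurable_addr.
pose h (m : int) t := (f t * (\1_D (t - m%:~R * (2 * pi)))%:E)%E.
have mind (c : R) : measurable_fun setT (fun t => ((\1_D : R -> R) (t + c))%:E).
  apply/measurable_EFinP; apply: measurableT_comp; last exact: measurable_addr.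
  by apply: measurable_indic; exact: measurable_period.
have mh m : measurable_fun setT (h m) by exact: emeasurable_funM.
have h0 m t : (0 <= h m t)%E by rewrite mule_ge0// lee_fin.
transitivity (\int[mu]_t \esum_(m in [set: int]) h m t)%E.
  apply: eq_integral => t _.
  have -> : (\esum_(m in [set: int]) h m t =
      \esum_(m in [set Num.floor (t / (2 * pi))]) f t)%E.
    rewrite [RHS]esum_mkcond; apply: eq_esum => m _; rewrite /h indicE.
    have [/set_mem/= ->|/negP mt] := boolP (m \in [set Num.floor (t / (2 * pi))]).
      by rewrite mem_set ?mule1//; apply/period_shiftP.
    by rewrite memNset ?mule0// => /period_shiftP tm; apply: mt; exact/mem_set.
  by rewrite esum_set1.
rewrite integral_esum_int// (integral_esum_int mu (@measurable_period R))//.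
apply: eq_esum => m _; rewrite [RHS]integral_mkcond.
rewrite -(ge0_integral_addr (m%:~R * (2 * pi)))//.
apply: eq_integral => t _; rewrite /h addrK patchE indicE.
by case: ifPn => _; rewrite ?mule1 ?mule0.
Qed.

Lemma Rintegral_shifted_period (f : R -> R) m : measurable_fun setT f ->
  \int[mu]_t (f t * \1_D (t - m%:~R * (2 * pi))) =
  \int[mu]_(s in D) samples f s m.
Proof.
move=> mf; rewrite [RHS]Rintegral_mkcond -(Rintegral_addr (m%:~R * (2 * pi))).
  apply: eq_Rintegral => t _; rewrite addrK patchE indicE.
  by case: ifPn => _; rewrite ?mulr1 ?mulr0.
apply: measurable_funM => //; apply: measurableT_comp; last exact: measurable_addr.
by apply: measurable_indic; exact: measurable_period.
Qed.

End Translation.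

(** * Inner products with the Weyl-Heisenberg system *)

Section WeylHeisenberg.
Variable R : realType.
Local Notation mu := (@lebesgue_measure R).
Local Notation D := (`[0, 2 * pi[%classic : set R).
Local Notation L2 := (square_integrable mu setT).

Lemma normc_sqr (z : R[i]) : ComplexField.Normc.normc z ^+ 2 =
  complex.Re z ^+ 2 + complex.Im z ^+ 2.
Proof.
by case: z => x y /=; rewrite sqr_sqrtr// addr_ge0// sqr_ge0.
Qed.

Lemma in_L2P (f : R -> R[i]) : in_L2 f <->
  L2 (fun t => complex.Re (f t)) /\ L2 (fun t => complex.Im (f t)).
Proof.
have norm2 : (fun t => (ComplexField.Normc.normc (f t) ^+ 2)%:E) =
    (fun t => ((complex.Re (f t)) ^+ 2)%:E + ((complex.Im (f t)) ^+ 2)%:E)%E.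
  by apply/funext => t; rewrite normc_sqr EFinD.
rewrite /in_L2 norm2; split.
  move=> [mr mi]; rewrite ge0_integralD//=; last 4 first.
  - by move=> t _; rewrite lee_fin sqr_ge0.
  - exact: measurable_sqr.
  - by move=> t _; rewrite lee_fin sqr_ge0.
  - exact: measurable_sqr.
  move=> ri; split; split=> //; apply: le_lt_trans ri.
    by rewrite leeDl// integral_ge0// => t _; rewrite lee_fin sqr_ge0.
  by rewrite leeDr// integral_ge0// => t _; rewrite lee_fin sqr_ge0.
move=> [[mr r2] [mi i2]]; split=> //; rewrite ge0_integralD//=.
- by rewrite lte_add_pinfty.
- by move=> t _; rewrite lee_fin sqr_ge0.
- exact: measurable_sqr.
- by move=> t _; rewrite lee_fin sqr_ge0.
- exact: measurable_sqr.
Qed.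

Lemma square_integrable_samples (f : R -> R) N : L2 f ->
  square_integrable mu D (fun s => samples f s N).
Proof.
move=> [mf f2]; have ms := measurable_samples N mf.
split=> //; apply: le_lt_trans f2.
rewrite -(ge0_integral_addr (N%:~R * (2 * pi)) (measurable_sqr mf)); last first.
  by move=> t; rewrite lee_fin sqr_ge0.
apply: (ge0_subset_integral _ (@measurable_period R)) => //.
- exact: (measurable_sqr ms).
- by move=> t _; rewrite lee_fin sqr_ge0.
Qed.

Variables (k : nat) (n : 'I_k.+1 -> int) (a : 'I_k.+1 -> R).

(** On the period this is the periodization of [f] times the window translated by [2 * pi * l]. Its
    square is also the [l]-th term of [shift_form] at the samples of [f]. *)
Definition fold (f : R -> R) (l : int) (s : R) : R :=
  \sum_(j < k.+1) a j * samples f s (l + n j).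

Definition step (t : R) : R :=
  \sum_(j < k.+1) a j * \1_(shifted_interval (n j)) t.

Lemma square_integrable_fold (f : R -> R) l : L2 f ->
  square_integrable mu D (fold f l).
Proof.
move=> sf; apply: square_integrable_sum; first exact: measurable_period.
move=> j; apply: square_integrableZ; first exact: measurable_period.
exact: square_integrable_samples.
Qed.

Lemma indic_shifted_interval (m : int) (t : R) :
  \1_(shifted_interval m) t = \1_D (t - m%:~R * (2 * pi)) :> R.
Proof.
rewrite !indicE; congr (_ %:R); congr nat_of_bool.
apply/idP/idP => /set_mem h; apply/mem_set.
  move: h => [s Ds <-]; suff -> : s + 2 * m%:~R * pi - m%:~R * (2 * pi) = s by [].
  by ring.
by exists (t - m%:~R * (2 * pi)) => //; ring.
Qed.

Lemma step_translate (l : int) (t : R) : step (t - l%:~R * (2 * pi)) =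
  \sum_(j < k.+1) a j * \1_D (t - (l + n j)%:~R * (2 * pi)).
Proof.
apply: eq_bigr => j _; rewrite indic_shifted_interval; congr (_ * \1_D _).
by rewrite rmorphD/=; ring.
Qed.

Section PeriodicWeight.
Variable w : R -> R.
Hypotheses (mw : measurable_fun setT w) (w1 : forall t, `|w t| <= 1).
Hypothesis wP : forall (m : int) t, w (t + m%:~R * (2 * pi)) = w t.

(** The weight [w] stands for [cos (m t)] or [sin (m t)]; here it is cut off to the [N]-th tile. *)
Let cell (N : int) (t : R) : R := w t * \1_D (t - N%:~R * (2 * pi)).

Let measurable_cell_indic N : measurable_fun setT
  (fun t : R => \1_D (t - N%:~R * (2 * pi)) : R).
Proof.
apply: measurableT_comp; last exact: measurable_addr.
by apply: measurable_indic; exact: measurable_period.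
Qed.

Let square_integrable_cell N : L2 (cell N).
Proof.
have mc0 : measurable_fun setT (cell N) by exact: measurable_funM.
have mc : measurable_fun [set: measurableTypeR R] (cell N) := mc0.
have sI : L2 (fun t => \1_D (t - N%:~R * (2 * pi))).
  split; first exact: measurable_cell_indic.
  have mD2 : measurable_fun setT (fun t : R => ((\1_D t : R) ^+ 2)%:E).
    by apply: measurable_sqr; apply: measurable_indic; exact: measurable_period.
  have D0 t : (0 <= ((\1_D t : R) ^+ 2)%:E)%E by rewrite lee_fin sqr_ge0.
  have /= -> := ge0_integral_addr (- (N%:~R * (2 * pi))) mD2 D0.
  have -> : (\int[mu]_t ((\1_D t : R) ^+ 2)%:E = \int[mu]_t (\1_D t)%:E)%E.
    by apply: eq_integral => t _; rewrite indicE; case: (t \in D);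
      rewrite /= ?expr1n ?expr0n.
  rewrite (integral_indic _ measurableT (@measurable_period R)).
  by have := ltry (2 * pi : R); rewrite -(lebesgue_measure_period R) setIT.
apply: (@square_integrableW _ _ _ _ _ measurableT _ _ mc sI) => t _.
rewrite /cell exprMn ler_piMl ?sqr_ge0//.
by rewrite -(real_normK (num_real (w t))) expr_le1.
Qed.

Lemma square_integrable_weight_step (l : int) :
  L2 (fun t => w t * step (t - l%:~R * (2 * pi))).
Proof.
have -> : (fun t => w t * step (t - l%:~R * (2 * pi))) =
    (fun t => \sum_(j < k.+1) a j * cell (l + n j) t).
  apply/funext => t; rewrite step_translate big_distrr/=.
  by apply: eq_bigr => j _; rewrite /cell mulrCA.
apply: (square_integrable_sum measurableT) => j.
by apply: (square_integrableZ measurableT); exact: square_integrable_cell.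
Qed.

(** The translated window is a combination of tile indicators. Moving the tile [l + n j] back to the
    period replaces [f] by its sample there and leaves the periodic [w] unchanged. *)
Lemma dot_weight_step (f : R -> R) (l : int) : L2 f ->
  dot mu setT f (fun t => w t * step (t - l%:~R * (2 * pi))) =
  dot mu D (fold f l) w.
Proof.
move=> sf; have mf : measurable_fun setT f by case: sf.
have sw : square_integrable mu D w.
  by apply: (@square_integrable_bounded _ _ 1) => // t _.
have -> : (fun t => w t * step (t - l%:~R * (2 * pi))) =
    (fun t => \sum_(j < k.+1) a j * cell (l + n j) t).
  apply/funext => t; rewrite step_translate big_distrr/=.
  by apply: eq_bigr => j _; rewrite /cell mulrCA.
have -> : dot mu D (fold f l) w =
    \sum_(j < k.+1) a j * dot mu D (fun s => samples f s (l + n j)) w.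
  apply: (dot_suml (@measurable_period R) _ _ _ sw) => j.
  exact: square_integrable_samples.
rewrite dotC (dot_suml measurableT)//.
apply: eq_bigr => j _; congr (_ * _).
have := Rintegral_shifted_period (l + n j) (measurable_funM mf mw).
rewrite /dot => h.
transitivity (\int[mu]_t (f t * w t * \1_D (t - (l + n j)%:~R * (2 * pi)))).
  by apply: eq_Rintegral => t _; rewrite /cell mulrC mulrA.
by rewrite h; apply: eq_Rintegral => s _; rewrite /samples /= wP.
Qed.

End PeriodicWeight.

End WeylHeisenberg.

(** * Frame coefficients, the frame sum as an integral of the form, and the upper bound of the
    form *)

Section FrameSum.
Variable R : realType.
Local Notation mu := (@lebesgue_measure R).
Local Notation D := (`[0, 2 * pi[%classic : set R).
Local Notation L2 := (square_integrable mu setT).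
Variables (k : nat) (n : 'I_k.+1 -> int) (a : 'I_k.+1 -> R).
Local Notation WH := (WH_system (2 * pi) 1 (step_function n a)).
Local Notation F := (fold n a).

Lemma WH_systemE (m l : int) (t : R) : WH (m, l) t =
  ((cos (m%:~R * t) * step n a (t - l%:~R * (2 * pi)))%R +i*
   (sin (m%:~R * t) * step n a (t - l%:~R * (2 * pi)))%R)%C.
Proof.
rewrite /WH_system /modulation /translation /step_function /= -/(step n a _).
by rewrite /expi mulr1; simpc.
Qed.

Lemma cosM_periodic (m l : int) (t : R) :
  cos (m%:~R * (t + l%:~R * (2 * pi))) = cos (m%:~R * t).
Proof. by rewrite mulrDr mulrA -rmorphM/= cosD2pi_int. Qed.

Lemma sinM_periodic (m l : int) (t : R) :
  sin (m%:~R * (t + l%:~R * (2 * pi))) = sin (m%:~R * t).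
Proof. by rewrite mulrDr mulrA -rmorphM/= sinD2pi_int. Qed.

Lemma normr_cos_le1 (x : R) : `|cos x| <= 1.
Proof. by rewrite ler_norml cos_geN1 cos_le1. Qed.

Lemma normr_sin_le1 (x : R) : `|sin x| <= 1.
Proof. by rewrite ler_norml sin_geN1 sin_le1. Qed.

Lemma square_integrable_cos_step (m l : int) :
  L2 (fun t => cos (m%:~R * t) * step n a (t - l%:~R * (2 * pi))).
Proof.
apply: square_integrable_weight_step; first exact: measurable_cosM.
by move=> t; exact: normr_cos_le1.
Qed.

Lemma square_integrable_sin_step (m l : int) :
  L2 (fun t => sin (m%:~R * t) * step n a (t - l%:~R * (2 * pi))).
Proof.
apply: square_integrable_weight_step; first exact: measurable_sinM.
by move=> t; exact: normr_sin_le1.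
Qed.

Lemma in_L2_WH_system (ml : int * int) : in_L2 (WH ml).
Proof.
case: ml => m l; apply/in_L2P; split.
  under eq_fun do rewrite WH_systemE; exact: square_integrable_cos_step.
under eq_fun do rewrite WH_systemE; exact: square_integrable_sin_step.
Qed.

Lemma dot_cos_step (f : R -> R) (m l : int) : L2 f ->
  dot mu setT f (fun t => cos (m%:~R * t) * step n a (t - l%:~R * (2 * pi))) =
  dot mu D (F f l) (fun t => cos (m%:~R * t)).
Proof.
apply: dot_weight_step; first exact: measurable_cosM.
  by move=> t; exact: normr_cos_le1.
by move=> l' t; exact: cosM_periodic.
Qed.

Lemma dot_sin_step (f : R -> R) (m l : int) : L2 f ->
  dot mu setT f (fun t => sin (m%:~R * t) * step n a (t - l%:~R * (2 * pi))) =
  dot mu D (F f l) (fun t => sin (m%:~R * t)).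
Proof.
apply: dot_weight_step; first exact: measurable_sinM.
  by move=> t; exact: normr_sin_le1.
by move=> l' t; exact: sinM_periodic.
Qed.

Section Coefficients.
Variable f : R -> R[i].
Hypothesis L2f : in_L2 f.
Local Notation f1 := (fun t => complex.Re (f t)).
Local Notation f2 := (fun t => complex.Im (f t)).

Let L2f1 : L2 f1. Proof. by case/in_L2P: L2f. Qed.
Let L2f2 : L2 f2. Proof. by case/in_L2P: L2f. Qed.

(** The window is real and the exponential is conjugated, whence the plus sign in the real part and
    the minus sign in the imaginary part. *)
Lemma L2_dot_WH (m l : int) : L2_dot f (WH (m, l)) =
  ((dot mu D (F f1 l) (fun t => cos (m%:~R * t)) +
    dot mu D (F f2 l) (fun t => sin (m%:~R * t)))%R +i*
   (dot mu D (F f2 l) (fun t => cos (m%:~R * t)) -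
    dot mu D (F f1 l) (fun t => sin (m%:~R * t)))%R)%C.
Proof.
have sc := square_integrable_cos_step m l.
have ss := square_integrable_sin_step m l.
rewrite -!dot_cos_step// -!dot_sin_step// /dot /L2_dot /Cintegral.
congr (_ +i* _)%C.
  rewrite -(@RintegralD _ _ _ mu)//; try exact: integrable_dot.
  apply: eq_Rintegral => t _; rewrite WH_systemE.
  by case: (f t) => x y /=; ring.
rewrite -(@RintegralB _ _ _ mu)//; try exact: integrable_dot.
apply: eq_Rintegral => t _; rewrite WH_systemE.
by case: (f t) => x y /=; ring.
Qed.

Lemma EFin_Re_L2_dot : (complex.Re (L2_dot f f))%:E =
  (\int[mu]_t (f1 t ^+ 2)%:E + \int[mu]_t (f2 t ^+ 2)%:E)%E.
Proof.
rewrite -!EFin_dot// -EFinD /dot -(@RintegralD _ _ _ mu)//; try exact: integrable_dot.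
congr EFin; apply: eq_Rintegral => t _.
by case: (f t) => x y /=; ring.
Qed.

End Coefficients.

(* Both sides are sums over [m] whose terms of index [m] and [- m] add up to the
   same value: the cross terms are odd in [m]. *)
Lemma parseval_complex (g h : R -> R) :
  square_integrable mu D g -> square_integrable mu D h ->
  (\esum_(m in [set: int])
    ((dot mu D g (fun t => cos (m%:~R * t)) +
      dot mu D h (fun t => sin (m%:~R * t))) ^+ 2 +
     (dot mu D h (fun t => cos (m%:~R * t)) -
      dot mu D g (fun t => sin (m%:~R * t))) ^+ 2)%:E)%E =
  ((2 * pi)%:E * (\int[mu]_(t in D) (g t ^+ 2)%:E +
                  \int[mu]_(t in D) (h t ^+ 2)%:E))%E.
Proof.
move=> sg sh; rewrite -!EFin_dot//; try exact: measurable_period.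
transitivity ((2 * pi * dot mu D g g)%:E + (2 * pi * dot mu D h h)%:E)%E;
  last by rewrite -EFinD -mulrDr EFinM EFinD.
rewrite -!parseval_cas//.
rewrite -esumD; try by move=> m _; rewrite lee_fin sqr_ge0.
apply: esum_int_symm => [m|m|m].
- by rewrite lee_fin addr_ge0// sqr_ge0.
- by rewrite adde_ge0// lee_fin sqr_ge0.
have casE (u : R -> R) (m' : int) : square_integrable mu D u -> dot mu D u (cas m') =
    dot mu D u (fun t => cos (m'%:~R * t)) + dot mu D u (fun t => sin (m'%:~R * t)).
  move=> su; rewrite (dotC mu D u) (dotDl (@measurable_period R))//.
  - by rewrite !(dotC mu D _ u).
  - exact: square_integrable_cos.
  - exact: square_integrable_sin.
have cosN (u : R -> R) : dot mu D u (fun t => cos ((- m)%:~R * t)) =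
    dot mu D u (fun t => cos (m%:~R * t)).
  by congr dot; apply/funext => t; rewrite rmorphN/= mulNr cosN.
have sinN (u : R -> R) : square_integrable mu D u ->
    dot mu D u (fun t => sin ((- m)%:~R * t)) =
    - dot mu D u (fun t => sin (m%:~R * t)).
  move=> su; rewrite (dotC mu D u (fun t => sin (m%:~R * t))).
  rewrite -[- dot _ _ _ _]mulN1r.
  rewrite -(dotZl (@measurable_period R))//; last exact: square_integrable_sin.
  by rewrite dotC; congr dot; apply/funext => t; rewrite rmorphN/= mulNr sinN mulN1r.
(* Both pairs of terms add up to twice the sum of the squares of the four cosine and sine
   coefficients of [g] and [h]. *)
rewrite !casE// !cosN !sinN// -!EFinD; congr EFin; ring.
Qed.

Lemma measurable_fold (f : R -> R) (l : int) : measurable_fun setT f ->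
  measurable_fun setT (F f l).
Proof.
move=> mf; apply: measurable_sum => j; apply: measurable_funM => //.
exact: measurable_samples.
Qed.

Lemma frame_sumE (f : R -> R[i]) : in_L2 f ->
  (\esum_(j in [set: int * int])
     (ComplexField.Normc.normc (L2_dot f (WH j)) ^+ 2)%:E)%E =
  ((2 * pi)%:E *
   (\int[mu]_(s in D) shift_form n a (samples (fun t => complex.Re (f t)) s) +
    \int[mu]_(s in D) shift_form n a (samples (fun t => complex.Im (f t)) s)))%E.
Proof.
move=> L2f; have [sf1 sf2] := (in_L2P f).1 L2f.
(* The pairs are swapped so that the modulations form the inner sum, to which Parseval's identity
   applies for each fixed translation [l]. *)
rewrite (@reindex_esum _ _ _ setT setT (fun lm : int * int => (lm.2, lm.1))); last first.
  split=> // [[l m] [l' m'] _ _ [-> ->]//|[m l] _].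
  by exists (l, m).
have -> : [set: int * int] = [set: int] `*`` (fun=> [set: int]).
  by apply/seteqP; split.
rewrite -(@esum_esum _ _ _ _ _ (fun l m =>
    (ComplexField.Normc.normc (L2_dot f (WH (m, l))) ^+ 2)%:E)); last first.
  by move=> l m _ _; rewrite lee_fin sqr_ge0.
have pi0 : 0 <= 2 * pi :> R by rewrite mulr_ge0// pi_ge0.
have I0 (g : R -> R) l : (0 <= \int[mu]_(s in D) (F g l s ^+ 2)%:E)%E.
  by apply: integral_ge0 => s _; rewrite lee_fin sqr_ge0.
transitivity (\esum_(l in [set: int]) ((2 * pi)%:E *
    (\int[mu]_(s in D) (F (fun t => complex.Re (f t)) l s ^+ 2)%:E +
     \int[mu]_(s in D) (F (fun t => complex.Im (f t)) l s ^+ 2)%:E)))%E.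
  apply: eq_esum => l _; rewrite -parseval_complex; try exact: square_integrable_fold.
  by apply: eq_esum => m _; rewrite normc_sqr L2_dot_WH.
rewrite esum_intZl//; last by move=> l; rewrite adde_ge0.
rewrite esumD//; congr (_ * (_ + _))%E.
  rewrite -(integral_esum_int mu (@measurable_period R))//.
  - by move=> l; apply: measurable_sqr; apply: measurable_fold; case: sf1.
  - by move=> l t; rewrite lee_fin sqr_ge0.
rewrite -(integral_esum_int mu (@measurable_period R))//.
- by move=> l; apply: measurable_sqr; apply: measurable_fold; case: sf2.
- by move=> l t; rewrite lee_fin sqr_ge0.
Qed.

Lemma integral_l2_sqnorm_samples (f : R -> R) : measurable_fun setT f ->
  (\int[mu]_(s in D) l2_sqnorm (samples f s) = \int[mu]_t (f t ^+ 2)%:E)%E.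
Proof.
move=> mf; rewrite (integral_periodize (measurable_sqr mf))//.
by move=> t; rewrite lee_fin sqr_ge0.
Qed.

Lemma measurable_l2_sqnorm_samples (f : R -> R) : measurable_fun setT f ->
  measurable_fun setT (fun s => l2_sqnorm (samples f s)).
Proof.
move=> mf; apply: measurable_esum_int => [m|m t].
  by apply: measurable_sqr; exact: measurable_samples.
by rewrite lee_fin sqr_ge0.
Qed.

Lemma measurable_shift_form_samples (f : R -> R) : measurable_fun setT f ->
  measurable_fun setT (fun s => shift_form n a (samples f s)).
Proof.
move=> mf; apply: measurable_esum_int => [m|m t].
  by apply: measurable_sqr; exact: measurable_fold.
by rewrite lee_fin sqr_ge0.
Qed.

Lemma shift_form_ge0 (x : int -> R) : (0 <= shift_form n a x)%E.
Proof. by apply: esum_ge0 => m _; rewrite lee_fin sqr_ge0. Qed.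

Lemma l2_sqnorm_ge0 (x : int -> R) : (0 <= l2_sqnorm x)%E.
Proof. by apply: esum_ge0 => m _; rewrite lee_fin sqr_ge0. Qed.

(** Iterates [(y + S) ^+ 2 <= 2 * y ^+ 2 + 2 * S ^+ 2]; the exponential constant is crude but
    sufficient. *)
Lemma sqr_sum_le (I : Type) (s : seq I) (y : I -> R) :
  (\sum_(i <- s) y i) ^+ 2 <= 2 ^+ size s * \sum_(i <- s) y i ^+ 2.
Proof.
elim: s => [|i s IH]; first by rewrite !big_nil expr0n/= mulr0.
rewrite !big_cons/= [2 ^+ (size s).+1]exprS.
set S := \sum_(j <- s) y j in IH *; set T := \sum_(j <- s) y j ^+ 2 in IH *.
have p1 : 1 <= 2 ^+ size s :> R by rewrite exprn_ege1// ler1n.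
have : 0 <= (y i - S) ^+ 2 by exact: sqr_ge0.
have : 0 <= (2 ^+ size s - 1) * y i ^+ 2 by rewrite mulr_ge0 ?sqr_ge0// subr_ge0.
have -> : 2 * 2 ^+ size s * (y i ^+ 2 + T) =
  2 * ((2 ^+ size s - 1) * y i ^+ 2) + 2 * y i ^+ 2 + 2 * (2 ^+ size s * T) by ring.
have -> : (y i - S) ^+ 2 = 2 * y i ^+ 2 + 2 * S ^+ 2 - (y i + S) ^+ 2 by ring.
lra.
Qed.

Definition upper_bound : R := 2 ^+ k.+1 * \sum_(j < k.+1) a j ^+ 2.

Lemma upper_bound_ge0 : 0 <= upper_bound.
Proof. by rewrite mulr_ge0 ?exprn_ge0// sumr_ge0// => j _; rewrite sqr_ge0. Qed.

(** Each term is bounded by [sqr_sum_le], and each of the [k.+1] shifts preserves the squared norm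
    of [x]. Besides the upper frame bound, this makes the form finite on square summable
    sequences. *)
Lemma shift_form_le (x : int -> R) :
  (shift_form n a x <= upper_bound%:E * l2_sqnorm x)%E.
Proof.
have x0 m : (0 <= (x m ^+ 2)%:E)%E by rewrite lee_fin sqr_ge0.
have c0 : 0 <= 2 ^+ k.+1 :> R by rewrite exprn_ge0.
apply: (@le_trans _ _ (\esum_(m in [set: int]) ((2 ^+ k.+1)%:E *
    \sum_(j < k.+1) ((a j ^+ 2)%:E * (x (m + n j)%R ^+ 2)%:E)))%E).
  apply: le_esum => m _; under [X in (_ <= _ * X)%E]eq_bigr do rewrite -EFinM.
  rewrite sumEFin -EFinM lee_fin.
  have := sqr_sum_le (index_enum 'I_k.+1) (fun j => a j * x (m + n j)).
  have -> : size (index_enum 'I_k.+1) = k.+1.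
    by rewrite -sum1_size sum1_card card_ord.
  under [in leRHS]eq_bigr do rewrite exprMn.
  exact.
have a0 j : (0 <= (a j ^+ 2)%:E)%E by rewrite lee_fin sqr_ge0.
rewrite esum_intZl//; last first.
  by move=> m; apply: sume_ge0 => j _; rewrite mule_ge0.
rewrite esum_sum; last by move=> m j _ _; rewrite mule_ge0.
have shiftE j : (\esum_(m in [set: int])
    ((a j ^+ 2)%:E * (x (m + n j)%R ^+ 2)%:E) = (a j ^+ 2)%:E * l2_sqnorm x)%E.
  rewrite esum_intZl ?sqr_ge0//; congr (_ * _)%E.
  exact: (esum_int_shift (n j) (fun m => (x m ^+ 2)%:E)).
rewrite (eq_bigr _ (fun j _ => shiftE j)).
rewrite -ge0_sume_distrl//.
by rewrite sumEFin muleA -EFinM.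
Qed.

End FrameSum.

(** * Frame bounds *)

Section FrameBounds.
Variable R : realType.
Local Notation mu := (@lebesgue_measure R).
Local Notation D := (`[0, 2 * pi[%classic : set R).
Local Notation L2 := (square_integrable mu setT).
Variables (k : nat) (n : 'I_k.+1 -> int) (a : 'I_k.+1 -> R).

Lemma integral_shift_form_ge (c : R) (f : R -> R) : 0 < c ->
  (forall x, in_l2 x -> (c%:E * l2_sqnorm x <= shift_form n a x)%E) -> L2 f ->
  (c%:E * \int[mu]_t (f t ^+ 2)%:E <=
   \int[mu]_(s in D) shift_form n a (samples f s))%E.
Proof.
move=> c0 cQ [mf f2].
have mD := @measurable_period R.
have ml := measurable_l2_sqnorm_samples mf.
have mD_l : measurable_fun D (fun s => l2_sqnorm (samples f s)).
  exact: measurable_funTS.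
rewrite -(integral_l2_sqnorm_samples mf) -ge0_integralZl_EFin//; last 2 first.
- by move=> s _; exact: l2_sqnorm_ge0.
- exact: ltW.
apply: ae_ge0_le_integral => //.
- by move=> s _; rewrite mule_ge0 ?l2_sqnorm_ge0// lee_fin ltW.
- exact: measurable_funeM.
- by move=> s _; exact: shift_form_ge0.
- by apply: measurable_funTS; exact: measurable_shift_form_samples.
(* The squared norms of the samples have integral [||f||^2], hence are finite almost everywhere, and
   only there does [cQ] apply. *)
have il : mu.-integrable D (fun s => l2_sqnorm (samples f s)).
  apply/integrableP; split=> //.
  under eq_integral do rewrite gee0_abs ?l2_sqnorm_ge0//.
  by rewrite integral_l2_sqnorm_samples.
have := integrable_ae mD il; apply: filterS => s fins Ds.
by apply: cQ; rewrite /in_l2 ltey_eq fins.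
Qed.

Lemma integral_shift_form_le (f : R -> R) : measurable_fun setT f ->
  (\int[mu]_(s in D) shift_form n a (samples f s) <=
   (upper_bound a)%:E * \int[mu]_t (f t ^+ 2)%:E)%E.
Proof.
move=> mf; have mD := @measurable_period R.
have mD_l : measurable_fun D (fun s => l2_sqnorm (samples f s)).
  by apply: measurable_funTS; exact: measurable_l2_sqnorm_samples.
rewrite -(integral_l2_sqnorm_samples mf) -ge0_integralZl_EFin//; last 2 first.
- by move=> s _; exact: l2_sqnorm_ge0.
- exact: upper_bound_ge0.
apply: ge0_le_integral => //.
- by move=> s _; exact: shift_form_ge0.
- by apply: measurable_funTS; exact: measurable_shift_form_samples.
- exact: measurable_funeM.
- by move=> s _; exact: shift_form_le.
Qed.

(** Constant on each tile, with value [x m] on the [m]-th one; it is the sequence of samples that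
    does not vary with [s] in the period. *)
Definition periodic_step (x : int -> R) (t : R) : R := x (Num.floor (t / (2 * pi))).

(** A preimage is the countable union of the tiles whose value lies in [B]. *)
Lemma measurable_periodic_step (x : int -> R) :
  measurable_fun setT (periodic_step x).
Proof.
move=> _ B mB; rewrite setTI.
have -> : periodic_step x @^-1` B = \bigcup_(m : int)
    ([set t | D (t - m%:~R * (2 * pi))] `&` [set _ | B (x m)]).
  apply/seteqP; split=> [t Bt|t [m _ [/period_shiftP <- Bt]]] //.
  exists (Num.floor (t / (2 * pi))) => //; split=> //.
  by apply/period_shiftP.
apply: countable_bigcupT_measurable; first exact: countableP.
move=> m; have [Bm|Bm] := pselect (B (x m)); last first.
  rewrite [X in measurable X](_ : _ = set0)//.
  by apply/seteqP; split=> t // [].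
rewrite [X in measurable X](_ : _ = (fun t => t + - (m%:~R * (2 * pi))) @^-1` D).
  rewrite -[X in measurable X]setTI; apply: (measurable_addr _ measurableT).
  exact: measurable_itv.
by apply/seteqP; split=> t // [].
Qed.

Lemma samples_periodic_step (x : int -> R) (s : R) : D s ->
  samples (periodic_step x) s = x.
Proof.
move=> Ds; apply/funext => m; rewrite /samples /periodic_step; congr x.
by apply/period_shiftP; rewrite addrK.
Qed.

End FrameBounds.

Theorem theorem4p1 (R : realType) (k : nat) (n : 'I_k.+1 -> int)
    (a : 'I_k.+1 -> R)
    (n_0 : n ord0 = 0)
    (n_increasing : forall i j : 'I_k.+1, (i < j)%N -> n i < n j)
    (a_neq0 : forall j : 'I_k.+1, a j != 0) :
  strongly_positive_definite (shift_form n a) <->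
  mother_WH_frame_wavelet (2 * pi) 1 (step_function n a).
Proof.
have pi2 : 0 < 2 * pi :> R by rewrite mulr_gt0 ?pi_gt0.
have I0 (f : R -> R) :
    (0 <= \int[@lebesgue_measure R]_t (f t ^+ 2)%:E)%E.
  by apply: integral_ge0 => t _; rewrite lee_fin sqr_ge0.
split.
  move=> [c c0 cQ]; split.
    (* The window is the element of index (0, 0) of its own system. *)
    have -> : step_function n a = WH_system (2 * pi) 1 (step_function n a) (0, 0).
      apply/funext => t; rewrite WH_systemE mulr0z !mul0r subr0 cos0 sin0.
      by rewrite mul0r mul1r.
    exact: in_L2_WH_system.
  split; first by move=> ml; exact: in_L2_WH_system.
  (* The factor [2 * pi] comes from [frame_sumE]; the maximum makes [A <= B] immediate. *)
  exists (2 * pi * c), (Num.max (2 * pi * c) (2 * pi * upper_bound a)).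
  split; [exact: mulr_gt0|by rewrite le_max lexx|].
  move=> f L2f; have [sf1 sf2] := (in_L2P f).1 L2f.
  rewrite /= frame_sumE// (EFinM (2 * pi * c)) (EFinM (Num.max _ _)).
  rewrite !EFin_Re_L2_dot//; split.
    rewrite (EFinM (2 * pi)) -muleA lee_pmul2l ?lte_fin// ge0_muleDr//.
    by apply: leeD; exact: integral_shift_form_ge.
  apply: (@le_trans _ _ ((2 * pi * upper_bound a)%:E *
    (\int[@lebesgue_measure R]_t (complex.Re (f t) ^+ 2)%:E +
     \int[@lebesgue_measure R]_t (complex.Im (f t) ^+ 2)%:E))%E); last first.
    apply: lee_wpmul2r; first by rewrite adde_ge0.
    by rewrite lee_fin le_max lexx orbT.
  rewrite (EFinM (2 * pi)) -muleA lee_pmul2l ?lte_fin// ge0_muleDr//.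
  by apply: leeD; apply: integral_shift_form_le; [case: sf1|case: sf2].
(* For the step function of [x], the frame sum is [(2 * pi) ^+ 2] times the form at [x], and the
   squared norm is [2 * pi] times that of [x]; hence the constant [A / (2 * pi)]. *)
move=> [_ [_ [A [B [A0 _ AS]]]]]; exists (A / (2 * pi)); first exact: divr_gt0.
move=> x x2; pose f t := (periodic_step x t)%:C%C.
have lx : l2_sqnorm x \is a fin_num by rewrite ge0_fin_numE// l2_sqnorm_ge0.
have mx := measurable_periodic_step x.
have mD := @measurable_period R.
have const_int (u : R -> \bar R) (v : \bar R) :
    (forall s, `[0, 2 * pi[%classic s -> u s = v) ->
    (\int[@lebesgue_measure R]_(s in `[0%R, (2 * pi)%R[) u s = v * (2 * pi)%:E)%E.
  move=> uv; rewrite -lebesgue_measure_period -integral_cst//.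
  by apply: eq_integral => s /set_mem /uv.
have norm_f : (\int[@lebesgue_measure R]_t (periodic_step x t ^+ 2)%:E =
    l2_sqnorm x * (2 * pi)%:E)%E.
  rewrite -integral_l2_sqnorm_samples//; apply: const_int => s Ds.
  by rewrite samples_periodic_step.
have norm_0 : (\int[@lebesgue_measure R]_t ((0 : R) ^+ 2)%:E = 0)%E.
  by under eq_integral do rewrite expr0n/=; rewrite integral0.
have L2f : in_L2 f.
  apply/in_L2P; split; split=> //=.
    by rewrite norm_f lte_mul_pinfty ?l2_sqnorm_ge0 ?ltry.
  by rewrite norm_0.
have [+ _] := AS f L2f.
rewrite frame_sumE// EFinM EFin_Re_L2_dot//= norm_f norm_0 adde0.
rewrite (const_int _ (shift_form n a x)); last first.
  by move=> s Ds; rewrite samples_periodic_step.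
(* The imaginary part of [f] is zero and contributes nothing. *)
rewrite (const_int _ 0%E); last first.
  move=> s Ds; apply: esum1 => m _; rewrite big1 ?expr0n// => j _.
  by rewrite mulr0.
rewrite mul0e adde0.
(* With the form finite at [x], the frame inequality becomes one between real numbers, where
   [2 * pi] can be cancelled. *)
have Qx : shift_form n a x \is a fin_num.
  rewrite ge0_fin_numE ?shift_form_ge0//.
  apply: le_lt_trans (shift_form_le n a x) _.
  by rewrite lte_mul_pinfty// lee_fin upper_bound_ge0.
rewrite -(fineK Qx) -(fineK lx) -!EFinM !lee_fin => h.
rewrite mulrAC ler_pdivrMr// -(ler_pM2r pi2); lra.
Qed.
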